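(* The class of $(2P_2,\overline{P_2+P_3})$-free atoms has bounded clique-width, whereas the class of all $(2P_2,\overline{P_2+P_3})$-free graphs has unbounded clique-width.
   Context: Graphs are finite, simple and undirected. A graph $G$ is $(H_1,\dots,H_p)$-free if it contains none of $H_1,\dots,H_p$ as an induced subgraph. A clique $K\subseteq V(G)$ (possibly empty) is a clique cut-set of $G$ if $G\setminus K$ is disconnected; an atom is a graph with no clique cut-set (so atoms are connected). $P_t$ is the path on $t$ vertices, $G_1+G_2$ is the disjoint union of vertex-disjoint graphs, $rG$ is the disjoint union of $r$ copies of $G$, and $\overline{G}$ is the complement of $G$. The clique-width $\mathrm{cw}(G)$ is the minimum number of labels needed to construct $G$ using four operations: create a new graph consisting of a single vertex with label $i$; take the disjoint union of two labelled graphs; add an edge between every vertex with label $i$ and every vertex with label $j$ ($i\ne j$); relabel every vertex with label $i$ to have label $j$. A class of graphs has bounded clique-width if there is a constant $c$ with $\mathrm{cw}(G)\le c$ for every $G$ in the class; otherwise its clique-width is unbounded. *)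

(* Defs.v *)
From mathcomp Require Import all_boot.
From mathcomp Require Import boolp.

Set Implicit Arguments.
Unset Strict Implicit.
Unset Printing Implicit Defensive.

Record sgraph := SGraph {
  vertex :> finType;
  adj : rel vertex;
  adj_sym : symmetric adj;
  adj_irr : irreflexive adj }.
Arguments SGraph : clear implicits.

Definition giso (G H : sgraph) : Prop :=
  exists f : G -> H, bijective f /\ forall x y, adj (f x) (f y) = adj x y.

Section Induced.
Variables (G : sgraph) (A : {set G}).
Definition induced_adj : rel {x : G | x \in A} :=
  fun x y => adj (val x) (val y).
Lemma induced_adj_sym : symmetric induced_adj.
Proof. by move=> x y; exact: adj_sym. Qed.
Lemma induced_adj_irr : irreflexive induced_adj.
Proof. by move=> x; exact: adj_irr. Qed.
Definition induced : sgraph :=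
  SGraph {x : G | x \in A} induced_adj induced_adj_sym induced_adj_irr.
End Induced.

Definition induced_subgraph (H G : sgraph) : Prop :=
  exists A : {set G}, giso H (induced A).

Definition free2 (H1 H2 G : sgraph) : Prop :=
  ~ induced_subgraph H1 G /\ ~ induced_subgraph H2 G.

(* With this convention the graph without vertices is connected, so deleting
   all the vertices of a complete graph does not disconnect it. *)
Definition connected (G : sgraph) : Prop :=
  forall x y : G, connect (@adj G) x y.

Definition clique (G : sgraph) (K : {set G}) : Prop :=
  {in K &, forall x y, x != y -> adj x y}.

Definition clique_cutset (G : sgraph) (K : {set G}) : Prop :=
  clique K /\ ~ connected (induced (~: K)).

Definition atom (G : sgraph) : Prop :=
  ~ exists K : {set G}, clique_cutset K.

Section PathGraph.
Variable t : nat.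
Definition path_adj : rel 'I_t := fun i j => (i.+1 == j) || (j.+1 == i).
Lemma path_adj_sym : symmetric path_adj.
Proof. by move=> i j; exact: orbC. Qed.
Lemma path_adj_irr : irreflexive path_adj.
Proof. by move=> i; rewrite /path_adj gtn_eqF. Qed.
Definition path_graph : sgraph :=
  SGraph 'I_t path_adj path_adj_sym path_adj_irr.
End PathGraph.

Section DisjointUnion.
Variables G1 G2 : sgraph.
Definition union_adj : rel (G1 + G2)%type := fun x y =>
  match x, y with
  | inl u, inl v => adj u v
  | inr u, inr v => adj u v
  | _, _ => false
  end.
Lemma union_adj_sym : symmetric union_adj.
Proof. by case=> x [] y //=; exact: adj_sym. Qed.
Lemma union_adj_irr : irreflexive union_adj.
Proof. by case=> x /=; exact: adj_irr. Qed.
Definition disjoint_union : sgraph :=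
  SGraph (G1 + G2)%type union_adj union_adj_sym union_adj_irr.
End DisjointUnion.

Section Copies.
Variables (r : nat) (G : sgraph).
Definition copies_adj : rel ('I_r * G)%type :=
  fun x y => (x.1 == y.1) && adj x.2 y.2.
Lemma copies_adj_sym : symmetric copies_adj.
Proof. by move=> x y; rewrite /copies_adj eq_sym adj_sym. Qed.
Lemma copies_adj_irr : irreflexive copies_adj.
Proof. by move=> x; rewrite /copies_adj adj_irr andbF. Qed.
Definition copies : sgraph :=
  SGraph ('I_r * G)%type copies_adj copies_adj_sym copies_adj_irr.
End Copies.

Section Complement.
Variable G : sgraph.
Definition compl_adj : rel G := fun x y => (x != y) && ~~ adj x y.
Lemma compl_adj_sym : symmetric compl_adj.
Proof. by move=> x y; rewrite /compl_adj eq_sym adj_sym. Qed.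
Lemma compl_adj_irr : irreflexive compl_adj.
Proof. by move=> x; rewrite /compl_adj eqxx. Qed.
Definition complement : sgraph := SGraph G compl_adj compl_adj_sym compl_adj_irr.
End Complement.

Record lgraph (k : nat) := LGraph {
  lgraph_graph :> sgraph;
  label : lgraph_graph -> 'I_k }.
Arguments LGraph {k}.

Section Single.
Variables (k : nat) (i : 'I_k).
Definition single_adj : rel unit := fun _ _ => false.
Lemma single_adj_sym : symmetric single_adj. Proof. by []. Qed.
Lemma single_adj_irr : irreflexive single_adj. Proof. by []. Qed.
Definition lsingle : lgraph k :=
  LGraph (SGraph unit single_adj single_adj_sym single_adj_irr) (fun _ => i).
End Single.

Definition lunion (k : nat) (G1 G2 : lgraph k) : lgraph k :=
  LGraph (disjoint_union G1 G2)
    (fun x => match x with inl u => label u | inr v => label v end).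

Section Join.
Variables (k : nat) (i j : 'I_k) (ij : i != j) (G : lgraph k).
Definition join_adj : rel G := fun x y =>
  [|| adj x y, (label x == i) && (label y == j)
    | (label x == j) && (label y == i)].
Lemma join_adj_sym : symmetric join_adj.
Proof.
move=> x y; rewrite /join_adj adj_sym; congr (_ || _).
by rewrite orbC ![(label y == _) && _]andbC.
Qed.
Lemma join_adj_irr : irreflexive join_adj.
Proof.
move=> x; rewrite /join_adj adj_irr /= [X in _ || X]andbC orbb.
by apply/negP => /andP [/eqP -> eij]; move: ij; rewrite eij.
Qed.
Definition ljoin : lgraph k :=
  LGraph (SGraph G join_adj join_adj_sym join_adj_irr) (@label k G).
End Join.

Definition lrelabel (k : nat) (i j : 'I_k) (G : lgraph k) : lgraph k :=
  LGraph G (fun x => if label x == i then j else label x).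

Inductive cw_expr (k : nat) : Type :=
| CWSingle (i : 'I_k)
| CWUnion (t1 t2 : cw_expr k)
| CWJoin (i j : 'I_k) (ij : i != j) (t : cw_expr k)
| CWRelabel (i j : 'I_k) (t : cw_expr k).

Fixpoint cw_eval (k : nat) (t : cw_expr k) : lgraph k :=
  match t with
  | CWSingle i => lsingle i
  | CWUnion t1 t2 => lunion (cw_eval t1) (cw_eval t2)
  | CWJoin i j ij t => ljoin ij (cw_eval t)
  | CWRelabel i j t => lrelabel i j (cw_eval t)
  end.

(* The four operations only produce graphs with at least one vertex; the graph
   without vertices is taken to need no label at all. *)
Definition cw_constructible (G : sgraph) (k : nat) : Prop :=
  #|G| = 0 \/ exists t : cw_expr k, giso (cw_eval t) G.

Section Existence.
Variable G : sgraph.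

Let represents (t : cw_expr #|G|) (A : pred G) (E : rel G) : Prop :=
  exists f : cw_eval t -> G,
    [/\ injective f, forall v, A v <-> exists x, f x = v,
        forall x, label x = enum_rank (f x) &
        forall x y, adj x y = E (f x) (f y)].

Let represents_edgeless v s : uniq (v :: s) ->
  exists t, represents t (mem (v :: s)) (fun _ _ => false).
Proof.
elim: s v => [|w s IH] v.
  move=> _; exists (CWSingle (enum_rank v)); exists (fun _ => v); split=> //.
    by case=> [] [].
  move=> u; split=> [|[_ <-]]; last exact: mem_head.
  by rewrite /= inE => /eqP ->; exists tt.
rewrite cons_uniq => /andP [vNs /IH [t [f [finj fim flab fadj]]]].
have fin x : f x \in w :: s by apply/fim; exists x.
exists (CWUnion (CWSingle (enum_rank v)) t).
exists (fun x : unit + cw_eval t => if x is inr y then f y else v); split.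
- case=> [[]|x] [[]|y] //= e; last by rewrite (finj _ _ e).
    by move: (fin y); rewrite -e (negPf vNs).
  by move: (fin x); rewrite e (negPf vNs).
- move=> u; split=> [|[[[]|y] <-]] /=.
  + rewrite inE => /orP [/eqP -> | /fim [x <-]]; first by exists (inl tt).
    by exists (inr x).
  + exact: mem_head.
  + by rewrite inE fin orbT.
- by case=> [[]|y] //=.
- by case=> [[]|x] [[]|y] //=.
Qed.

Let represents_edges t (l : seq (G * G)) :
  represents t predT (fun _ _ => false) -> all (fun p => adj p.1 p.2) l ->
  exists t', represents t' predT
               (fun x y => ((x, y) \in l) || ((y, x) \in l)).
Proof.
move=> rt; elim: l => [|[u v] l IH] /=; first by exists t.
case/andP=> auv /IH [t' [f [finj fim flab fadj]]].
have uv : enum_rank u != enum_rank v.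
  by rewrite (inj_eq enum_rank_inj); apply: contraTneq auv => ->; rewrite adj_irr.
exists (CWJoin uv t'); exists f; split=> // x y.
rewrite [LHS]/= /join_adj fadj !flab !(inj_eq enum_rank_inj) !inE.
rewrite !xpair_eqE (andbC (f y == u)) orbACA.
by congr (_ || _); exact: orbC.
Qed.

Lemma cw_constructible_card : cw_constructible G #|G|.
Proof.
case: (posnP #|G|) => [G0|G_gt0]; first by left.
right; case E: (enum G) => [|v s]; first by rewrite cardE E in G_gt0.
have [t rt] : exists t, represents t (mem (v :: s)) (fun _ _ => false).
  by apply: represents_edgeless; rewrite -E enum_uniq.
have {}rt : represents t predT (fun _ _ => false).
  case: rt => f [finj fim flab fadj]; exists f; split=> // u; split=> // _.
  by apply/fim; rewrite -E /= mem_enum.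
pose l := [seq p <- enum {: G * G} | adj p.1 p.2].
have [|t' [f [finj fim _ fadj]]] := @represents_edges t l rt.
  exact: filter_all.
exists t'; exists f; split.
  apply: inj_card_bij => //; rewrite -(card_codom finj).
  apply/subset_leq_card/subsetP => v' _.
  by have [/(_ isT) [x <-] _] := fim v'; exact: codom_f.
have lE u w : ((u, w) \in l) = adj u w.
  by rewrite mem_filter mem_enum andbT.
by move=> x y; rewrite fadj !lE [adj (f y) _]adj_sym orbb.
Qed.

Lemma cw_constructible_ex : exists k, `[< cw_constructible G k >].
Proof. by exists #|G|; apply/asboolP; exact: cw_constructible_card. Qed.
End Existence.

Definition cw (G : sgraph) : nat := ex_minn (cw_constructible_ex G).

Definition bounded_cw (C : sgraph -> Prop) : Prop :=
  exists c : nat, forall G : sgraph, C G -> cw G <= c.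

(* Main.v *)
Require Import Defs.
From mathcomp Require Import all_boot zify.
From mathcomp Require Import boolp.

(* Unboundedness is witnessed by the split graphs whose clique consists of all
   subsets of an m-set and whose independent set is the m-set itself: a graph of
   clique-width k has a vertex set A that is balanced on the independent part and
   whose vertices have at most k neighbourhoods outside A, while any half of the
   subsets distinguishes the elements of the m-set up to pairs.

   For boundedness, note that in the complement of P_2 + P_3 two non-adjacent
   vertices have three common neighbours spanning a single edge; so in the graphs
   considered non-adjacency is transitive on the common neighbours of two
   non-adjacent vertices.  In an atom with non-adjacent b and w, the neighbours of
   b that have a neighbour outside N[b] separate b from w, hence are not a clique,
   and 2P_2-freeness yields an induced C_4 or C_5.
   - Around a C_5, up to 15 vertices, each vertex is a twin of a vertex of the
     cycle, complete to the cycle (such vertices form a clique U) or anticomplete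
     to it (such vertices form an independent set Z).  For z in Z the atom property
     gives two non-adjacent neighbours of z, and these force z to be complete to U.
   - Around a C_4 without C_5, up to 4 vertices, the graph is the join of a complete
     multipartite graph and of a 2P_2-free bipartite graph.  The vertices that are
     complete to neither pair of opposite vertices of the cycle are independent,
     and a non-adjacent pair of neighbours decides which side they belong to.
   In both cases the vertices can be added layer by layer so that adjacency to
   earlier vertices only depends on boundedly many colours. *)

Set Implicit Arguments.
Unset Strict Implicit.
Unset Printing Implicit Defensive.

(** * Induced subgraphs *)

Lemma induced_subgraphP (H G : sgraph) :
  induced_subgraph H G <->
  exists f : H -> G, injective f /\ forall x y, adj (f x) (f y) = adj x y.
Proof.
split=> [[A [f [fbij fadj]]]|[f [finj fadj]]].
  exists (fun x => val (f x)); split; last exact: fadj.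
  by apply: inj_comp; [exact: val_inj | exact: bij_inj].
pose A : {set G} := [set f x | x : H].
have fA x : f x \in A by exact: imset_f.
exists A; exists (fun x => exist _ (f x) (fA x)); split; last exact: fadj.
apply: inj_card_bij => [x y [/finj] //|].
by rewrite card_sig card_imset.
Qed.

(** Vertices with the same image have the same neighbours, so injectivity can fail only on twins of
    [H]. *)
Lemma adj_morph_inj (H G : sgraph) (f : H -> G) :
  (forall x y, adj (f x) (f y) = adj x y) ->
  (forall x y, adj x =1 adj y -> f x = f y -> x = y) -> injective f.
Proof. by move=> fadj finj x y e; apply: finj => // z; rewrite -!fadj e. Qed.

Definition is_2K2 (G : sgraph) (a b c d : G) :=
  [&& adj a b, adj c d, ~~ adj a c, ~~ adj a d, ~~ adj b c & ~~ adj b d].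

Lemma induced_2P2P (G : sgraph) :
  induced_subgraph (copies 2 (path_graph 2)) G <->
  exists a b c d : G, is_2K2 a b c d.
Proof.
rewrite induced_subgraphP; split=> [[f [_ fadj]]|[a [b [c [d]]]]].
  pose i0 : 'I_2 := ord0; pose i1 : 'I_2 := ord_max.
  exists (f (i0, i0)), (f (i0, i1)), (f (i1, i0)), (f (i1, i1)).
  by rewrite /is_2K2 !fadj.
case/and5P=> ab cd /negbTE ac /negbTE ad /andP [/negbTE bc /negbTE bd].
pose f (x : 'I_2 * 'I_2) := nth a [:: a; b; c; d] (x.1 * 2 + x.2).
have fadj x y : adj (f x) (f y) = @adj (copies 2 (path_graph 2)) x y.
  case: x y => [[[|[|//]] ?] [[|[|//]] ?]] [[[|[|//]] ?] [[|[|//]] ?]];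
    rewrite /f /= ?adj_irr ?ab ?cd ?ac ?ad ?bc ?bd //;
    by rewrite adj_sym ?ab ?cd ?ac ?ad ?bc ?bd.
exists f; split=> //;
  apply: (@adj_morph_inj (copies 2 (path_graph 2)) G f fadj) => x y + _.
pose i0 : 'I_2 := ord0; pose i1 : 'I_2 := ord_max.
move=> e; move: (e (i0, i0)) (e (i0, i1)) (e (i1, i0)) (e (i1, i1)); move: e.
case: x y => [[[|[|//]] ?] [[|[|//]] ?]] [[[|[|//]] ?] [[|[|//]] ?]] //= *.
all: by congr pair; apply: val_inj.
Qed.

(* The complement of P_2 + P_3: the vertices a and b of the P_2 become non-adjacent
   and adjacent to the complement of the path x - y - z, whose only edge is xz. *)
Definition is_coP2P3 (G : sgraph) (a b x y z : G) :=
  [&& a != b, ~~ adj a b, [&& adj a x, adj a y & adj a z],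
      [&& adj b x, adj b y & adj b z] & [&& ~~ adj x y, ~~ adj y z & adj x z]].

Lemma induced_coP2P3P (G : sgraph) :
  induced_subgraph
    (complement (disjoint_union (path_graph 2) (path_graph 3))) G <->
  exists a b x y z : G, is_coP2P3 a b x y z.
Proof.
pose i0 : 'I_2 := ord0; pose i1 : 'I_2 := ord_max.
pose j0 : 'I_3 := ord0; pose j1 : 'I_3 := Ordinal (isT : 1 < 3).
pose j2 : 'I_3 := ord_max.
rewrite induced_subgraphP; split=> [[f [finj fadj]]|[a [b [x [y [z]]]]]].
  exists (f (inl i0)), (f (inl i1)), (f (inr j0)), (f (inr j1)), (f (inr j2)).
  by rewrite /is_coP2P3 !fadj (inj_eq finj).
case/and5P=> aNb /negbTE ab /and3P [ax ay az] /and3P [bx b_y bz].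
case/and3P=> /negbTE xy /negbTE yz xz.
pose f (u : 'I_2 + 'I_3) :=
  match u with inl i => nth a [:: a; b] i | inr j => nth a [:: x; y; z] j end.
pose H := complement (disjoint_union (path_graph 2) (path_graph 3)).
have fadj u v : adj (f u) (f v) = @adj H u v.
  case: u v => [[[|[|//]] ?]|[[|[|[|//]]] ?]] [[[|[|//]] ?]|[[|[|[|//]]] ?]];
    rewrite /f /= ?adj_irr ?ab ?ax ?ay ?az ?bx ?b_y ?bz ?xy ?yz ?xz //;
    by rewrite adj_sym ?ab ?ax ?ay ?az ?bx ?b_y ?bz ?xy ?yz ?xz.
exists f; split=> //; apply: (@adj_morph_inj H G f fadj) => u v e.
have := (e (inl i0), e (inl i1), e (inr j0), e (inr j1), e (inr j2)).
case: u v {e} => [[[|[|//]] ?]|[[|[|[|//]]] ?]] [[[|[|//]] ?]|[[|[|[|//]]] ?]].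
all: rewrite /= ?compl_adj /=; case; do ?case => //; move=> *.
all: try by congr (inl _); apply: val_inj.
all: try by congr (inr _); apply: val_inj.
(* The two vertices of the P_2 are the only twins; [aNb] separates them. *)
all: by case/eqP: aNb.
Qed.

(** * Split graphs have unbounded clique-width *)

Definition same_nbrs_outside (G : sgraph) (A : {set G}) (x y : G) :=
  forall z, z \notin A -> adj x z = adj y z.

(** Descend from the root, at each union into a part with at least [s] vertices of [W], until at
    most [s.*2] are left. The colours are the labels at that point: later operations treat equal
    labels alike, which is why the induction also carries equality of labels. *)
Lemma cw_eval_cut k (t : cw_expr k) (W : {set cw_eval t}) s :
  0 < s <= #|W| ->
  exists A : {set cw_eval t}, s <= #|W :&: A| <= s.*2 /\
  exists c : cw_eval t -> 'I_k, {in A &, forall x y, c x = c y ->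
    label x = label y /\ same_nbrs_outside A x y}.
Proof.
elim: t W => [i|t1 IH1 t2 IH2|i j ij t IH|i j t IH] W /andP [s0 sW].
- exists [set: unit]; rewrite setIT sW; split.
    apply: leq_trans (max_card _) _.
    by rewrite card_unit; case: s s0 {sW}.
  by exists (fun=> i) => x y _ _ _; split=> // z; rewrite inE.
- have [small|/ltnW big] := leqP #|W| s.*2.
    exists [set: _]; rewrite setIT sW small; split=> //.
    by exists (@label k _) => x y _ _ e; split=> // z; rewrite inE.
  pose W1 : {set cw_eval t1} := [set x | inl x \in W].
  pose W2 : {set cw_eval t2} := [set x | inr x \in W].
  have cW : #|W| = #|W1| + #|W2|.
    by rewrite -sum1_card big_sumType /= !sum1_card !cardsE.
  have inlI : injective (inl : cw_eval t1 -> cw_eval t1 + cw_eval t2).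
    by move=> x y [].
  have inrI : injective (inr : cw_eval t2 -> cw_eval t1 + cw_eval t2).
    by move=> x y [].
  case: (leqP s #|W1|) => [s1|/ltnW s1].
    have [|A [sA [c cA]]] := IH1 W1; first by rewrite s0.
    exists [set inl x | x in A]; split.
      suff -> : W :&: [set inl x | x in A] = [set inl x | x in W1 :&: A].
        by rewrite card_imset.
      apply/setP=> -[x|x]; last first.
        by rewrite !inE; apply/andP/imsetP => [[_ /imsetP [?]]|[?]].
      by rewrite !inE !mem_imset // !inE.
    exists (fun x => match x with inl x => c x | inr x => label x end).
    move=> _ _ /imsetP [x xA ->] /imsetP [y yA ->] /= /(cA _ _ xA yA) [-> e].
    split=> // -[z|z] //=; rewrite mem_imset //; exact: e.
  have [|A [sA [c cA]]] := IH2 W2.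
    by rewrite s0 /= -(leq_add2l s) addnn (leq_trans big) // cW leq_add2r.
  exists [set inr x | x in A]; split.
    suff -> : W :&: [set inr x | x in A] = [set inr x | x in W2 :&: A].
      by rewrite card_imset.
    apply/setP=> -[x|x].
      by rewrite !inE; apply/andP/imsetP => [[_ /imsetP [?]]|[?]].
    by rewrite !inE !mem_imset // !inE.
  exists (fun x => match x with inr x => c x | inl x => label x end).
  move=> _ _ /imsetP [x xA ->] /imsetP [y yA ->] /= /(cA _ _ xA yA) [-> e].
  split=> // -[z|z] //=; rewrite mem_imset //; exact: e.
- have [|A [sA [c cA]]] := IH W; first by rewrite s0.
  exists A; split=> //; exists c => x y xA yA /(cA _ _ xA yA) [e1 e2].
  by split=> // z zA; rewrite /= /join_adj e1 e2.
- have [|A [sA [c cA]]] := IH W; first by rewrite s0.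
  exists A; split=> //; exists c => x y xA yA /(cA _ _ xA yA) [e1 e2].
  by split=> //=; rewrite e1.
Qed.

Lemma cw_constructible_cut k (G : sgraph) (W : {set G}) s :
  cw_constructible G k -> 0 < s <= #|W| ->
  exists A : {set G}, s <= #|W :&: A| <= s.*2 /\
  exists c : G -> 'I_k,
    {in A &, forall x y, c x = c y -> same_nbrs_outside A x y}.
Proof.
case=> [G0 /andP [s0 sW]|[t [f [fbij fadj]]] sW].
  by have := leq_trans sW (max_card _); rewrite G0 leqNgt s0.
have [g fK gK] := fbij.
have [|A [sA [c cA]]] := @cw_eval_cut k t (f @^-1: W) s.
  by rewrite on_card_preimset //; exact: onW_bij.
exists (f @: A); split.
  suff -> : W :&: f @: A = f @: (f @^-1: W :&: A).
    by rewrite card_imset //; exact: bij_inj.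
  by apply/setP=> x; rewrite -(gK x) !inE !mem_imset ?inE //; exact: bij_inj.
exists (c \o g) => _ _ /imsetP [x xA ->] /imsetP [y yA ->] /=.
rewrite !fK => /(cA _ _ xA yA) [_ e] z; rewrite -(gK z) mem_imset.
  by rewrite !fadj; exact: e.
exact: bij_inj.
Qed.

Lemma card_set_of (T : finType) : #|{set T}| = 2 ^ #|T|.
Proof. by have := card_powerset [set: T]; rewrite powersetT !cardsT. Qed.

Section SplitGraph.
Variable m : nat.

Definition split_adj : rel ({set 'I_m} + 'I_m)%type := fun x y =>
  match x, y with
  | inl A, inl B => A != B
  | inl A, inr i => i \in A
  | inr i, inl A => i \in A
  | inr _, inr _ => false
  end.
Lemma split_adj_sym : symmetric split_adj.
Proof. by case=> [A|i] [B|j] //=; rewrite eq_sym. Qed.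
Lemma split_adj_irr : irreflexive split_adj.
Proof. by case=> [A|i] //=; rewrite eqxx. Qed.
Definition split_graph : sgraph :=
  SGraph ({set 'I_m} + 'I_m)%type split_adj split_adj_sym split_adj_irr.

(** Every edge has an end in the clique, which rules out 2P_2; the vertices [a], [x], [b], [y] of
    the other graph form an induced C_4, which no split graph contains. *)
Lemma split_graph_free :
  free2 (copies 2 (path_graph 2))
    (complement (disjoint_union (path_graph 2) (path_graph 3))) split_graph.
Proof.
split.
{ rewrite induced_2P2P => -[a [b [c [d]]]]; rewrite /is_2K2.
  case: a b c d => [A|i] [B|j] [C|k] [D|l] //=; rewrite ?andbF ?negbK //=.
  all: repeat match goal with
    | |- is_true (_ && _) -> _ => case/andP=> ?
    | |- is_true _ -> _ => move=> ?
    | H : is_true (_ && _) |- _ => case/andP: H => ? ?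
    | H : is_true (_ == _) |- _ => move/eqP: H => H; subst end.
  all: by match goal with
    | H : is_true (~~ ?b), H' : is_true ?b |- _ => rewrite H' in H
    | H : is_true (?x != ?x) |- _ => rewrite eqxx in H end. }
rewrite induced_coP2P3P => -[a [b [x [y [z]]]]]; rewrite /is_coP2P3.
case: a b x y z => [A|i] [B|j] [X|k] [Y|l] [Z|n] //=;
  rewrite ?andbF ?negbK //=.
all: repeat match goal with
  | |- is_true (_ && _) -> _ => case/andP=> ?
  | |- is_true _ -> _ => move=> ?
  | H : is_true (_ && _) |- _ => case/andP: H => ? ?
  | H : is_true (_ == _) |- _ => move/eqP: H => H; subst end.
all: by match goal with
    | H : is_true (inl ?x != inl ?x) |- _ => rewrite eqxx in H
    | H : is_true (?x != ?x) |- _ => rewrite eqxx in H end.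
Qed.

(* T and its images under toggling i and under toggling j are disjoint. *)
Lemma few_triples_unseparated (T : {set {set 'I_m}}) i j l :
  i != j -> i != l -> j != l ->
  {in T, forall B : {set 'I_m}, (i \in B) = (j \in B) /\ (i \in B) = (l \in B)} ->
  3 * #|T| <= 2 ^ m.
Proof.
move=> ij il jl hT.
pose tg i (B : {set 'I_m}) := [set x | (x \in B) (+) (x == i)].
have tgI a : injective (tg a).
  apply: (can_inj (g := tg a)) => B; apply/setP=> x.
  by rewrite !inE -addbA addbb addbF.
have dsj (A B : {set {set 'I_m}}) :
  {in A, forall x, x \notin B} -> #|A :|: B| = #|A| + #|B|.
  move=> d; rewrite cardsU; suff -> : A :&: B = set0 by rewrite cards0 subn0.
  by apply/setP=> x; rewrite !inE; apply/negP=> /andP [/d /negP].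
have := max_card (mem (T :|: (tg i @: T :|: tg j @: T))).
rewrite !dsj.
- by rewrite !card_imset // card_set_of card_ord !mulSn mul0n addn0.
- move=> _ /imsetP [B /hT [e1 e2] ->]; apply/imsetP=> -[C /hT [e3 e4] /setP e].
  move: (e i) (e j) (e l); rewrite !inE !eqxx (negbTE ij) eq_sym (negbTE ij).
  rewrite ![l == _]eq_sym (negbTE il) (negbTE jl) -e1 -e2 -e3 -e4.
  by do 2!case: (i \in _).
- move=> B /hT [e1 e2]; rewrite !inE; apply/orP=> -[] /imsetP [C /hT [e3 e4] e].
    move: e1 e2; rewrite e !inE !eqxx ![_ == i]eq_sym (negbTE ij) (negbTE il).
    by rewrite -e3; case: (i \in _).
  move: e1 e2; rewrite e !inE !eqxx (negbTE ij) eq_sym.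
  by rewrite -e3; case: (i \in _).
Qed.

(** Each colour occurs at most twice on [S]: three elements of one colour would give
    [3 * #|T| <= 2 ^ m <= 2 * #|T|], although [T] is not empty. *)
Lemma separating_colours (T : {set {set 'I_m}}) (X : finType) (S : {set 'I_m})
    (h : 'I_m -> X) :
  2 ^ m <= 2 * #|T| ->
  {in S &, forall i j, h i = h j ->
     {in T, forall B : {set 'I_m}, (i \in B) = (j \in B)}} ->
  #|S| <= 2 * #|X|.
Proof.
move=> bigT hS; rewrite mulnC -sum_nat_const -sum1_card.
rewrite (partition_big h predT) //= leq_sum // => x _; rewrite sum1_card.
rewrite leqNgt; apply/negP=> /card_gt2P [i [j [l [[]]]]].
rewrite !unfold_in => /andP [iS /eqP hi] /andP [jS /eqP hj] /andP [lS /eqP hl].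
case=> ij jl li.
have := @few_triples_unseparated T i j l ij _ jl; rewrite eq_sym => /(_ li).
have hT : {in T, forall B : {set 'I_m},
    (i \in B) = (j \in B) /\ (i \in B) = (l \in B)}.
  by move=> B BT; split; apply: hS => //; rewrite hi ?hj ?hl.
move=> /(_ hT) le3; have := leq_trans le3 bigT.
rewrite leq_mul2r orbF => /eqP T0; move: bigT.
by rewrite T0 muln0 leqn0 expn_eq0.
Qed.

(** For a balanced [A], either the subsets inside [A] are at least half of all and bound the number
    of elements outside [A], or those outside are and bound the number of elements inside. *)
Lemma cw_split_graph k : cw_constructible split_graph k -> m < 6 * 2 ^ k + 3.
Proof.
move=> Gk; rewrite ltnNge; apply/negP=> mk.
(* With this [s] a balanced [A] contains more than [2 * 2 ^ k] elements but at most [4 * 2 ^ k + 2],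
   so more than [2 * 2 ^ k] remain outside. *)
pose s := (2 * 2 ^ k).+1.
pose W : {set split_graph} := [set inr i | i : 'I_m].
have cW : #|W| = m by rewrite card_imset ?card_ord // => i j [].
have ms : 3 * s <= m by lia.
have [|A [/andP [sA As] [c cA]]] := @cw_constructible_cut k _ W s Gk.
  by rewrite cW (leq_trans _ ms) // leq_pmull.
pose T : {set {set 'I_m}} := [set B | inl B \in A].
pose S : {set 'I_m} := [set i | inr i \in A].
have cS : #|W :&: A| = #|S|.
  have inrI : injective (inr : 'I_m -> split_graph) by move=> ? ? [].
  rewrite -(card_imset S inrI); apply: eq_card => x; rewrite !inE; apply/andP/imsetP.
    by case=> /imsetP [i _ ->] iA; exists i; rewrite ?inE.
  by case=> i; rewrite inE => iA ->; rewrite imset_f.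
have k2 : k <= 2 ^ k by apply: ltnW; exact: ltn_expl.
have cT : #|T| + #|~: T| = 2 ^ m.
  by rewrite cardsC card_set_of card_ord.
case: (leqP (2 ^ m) (2 * #|T|)) => [bigT|smallT].
  have : #|~: S| <= 2 * #|{set 'I_k}|.
    (* An element outside [A] is coloured by the set of colours of the members of [T] containing it.
       Members of one colour agree on it, so this set decides which of them contain it. *)
    apply: (@separating_colours T _ _
      (fun i => [set l | [exists B in T, (c (inl B) == l) && (i \in B)]])) => //.
    have half i j : i \in ~: S -> j \in ~: S -> 
      [set l | [exists B in T, (c (inl B) == l) && (i \in B)]]
      = [set l | [exists B in T, (c (inl B) == l) && (j \in B)]] ->
      {in T, forall B : {set 'I_m}, (i \in B) -> (j \in B)}.
      rewrite !inE => iS jS /setP e B BT iB.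
      have := e (c (inl B)); rewrite !inE.
      have -> : [exists B0 in T, (c (inl B0) == c (inl B)) && (i \in B0)].
        by apply/existsP; exists B; rewrite BT eqxx.
      move=> /esym /existsP [C /and3P [CT /eqP cC jC]].
      rewrite !inE in BT CT.
      by have := cA _ _ CT BT cC (inr j) jS; rewrite /= jC.
    by move=> i j iS jS e B BT; apply/idP/idP; apply: half.
  rewrite card_set_of card_ord => le2.
  by have := cardsC S; rewrite card_ord; lia.
have bigT : 2 ^ m <= 2 * #|~: T| by lia.
have : #|S| <= 2 * #|'I_k|.
  apply: (@separating_colours _ _ _ (c \o inr) bigT) => i j.
  rewrite !inE => iA jA /(cA _ _ iA jA) e B; rewrite !inE => BA.
  exact: (e (inl B)).
by rewrite card_ord; lia.
Qed.
End SplitGraph.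

Lemma unbounded_cw_split_graphs (C : sgraph -> Prop) :
  (forall m, C (split_graph m)) -> ~ bounded_cw C.
Proof.
move=> Csplit [k cwk]; pose m := 6 * 2 ^ k + 3.
have := cwk _ (Csplit m); rewrite /cw; case: ex_minnP => j /asboolP Gj _ jk.
have := cw_split_graph Gj; rewrite ltnNge leq_add2r leq_mul2l /=.
by rewrite leq_exp2l // jk.
Qed.

(** * Layered constructions *)

Section Built.
Variables (G : sgraph) (L : finType).
Implicit Types (A B : {set G}) (E : rel G) (f : G -> L).

(* Labels are taken in an arbitrary finite type and edges in a relation that is
   only relevant on A, so that partially joined graphs can be described; the
   empty graph is allowed although no expression evaluates to it. *)
Definition built A E f :=
  A = set0 \/ exists (t : cw_expr #|L|) (g : cw_eval t -> G),
    [/\ injective g, forall v, v \in A <-> exists x, g x = v,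
        forall x, label x = enum_rank (f (g x)) &
        forall x y, adj x y = E (g x) (g y)].

Lemma built_eq A E E' f f' :
  built A E f -> {in A, f =1 f'} -> {in A &, E =2 E'} -> built A E' f'.
Proof.
move=> [->|[t [g [gI gA gf gE]]]] ef eE; first by left.
have gin x : g x \in A by apply/gA; exists x.
right; exists t, g; split=> // [x|x y]; first by rewrite -ef.
by rewrite -eE.
Qed.

Lemma built1 v E f : ~~ E v v -> built [set v] E f.
Proof.
move=> Ev; right; exists (CWSingle (enum_rank (f v))), (fun=> v); split=> //.
- by move=> [] [].
- by move=> u; rewrite inE; split=> [/eqP ->|[_ <-]] //; exists tt.
- by move=> x y /=; rewrite (negbTE Ev).
Qed.

Lemma builtU A B E f : [disjoint A & B] ->
  {in A & B, forall x y, ~~ E x y && ~~ E y x} ->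
  built A E f -> built B E f -> built (A :|: B) E f.
Proof.
move=> dAB EAB [->|[t1 [g1 [g1I g1A g1f g1E]]]]; first by rewrite set0U.
case=> [->|[t2 [g2 [g2I g2B g2f g2E]]]].
  by rewrite setU0; right; exists t1, g1.
have in1 x : g1 x \in A by apply/g1A; exists x.
have in2 x : g2 x \in B by apply/g2B; exists x.
have neq x y : g1 x <> g2 y.
  by move=> e; have := disjointFr dAB (in1 x); rewrite e in2.
right; exists (CWUnion t1 t2).
exists (fun x => match x with inl x => g1 x | inr x => g2 x end); split.
- by move=> [x|x] [y|y] => [/g1I ->|/neq|/esym/neq|/g2I ->].
- move=> v; rewrite inE; split=> [/orP [/g1A|/g2B] [x <-]|[[x|x] <-]].
  + by exists (inl x).
  + by exists (inr x).
  + by rewrite in1.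
  + by rewrite in2 orbT.
- by case.
- move=> [x|x] [y|y] //=; last first.
    by case/andP: (EAB _ _ (in1 y) (in2 x)) => _ /negbTE.
  by case/andP: (EAB _ _ (in1 x) (in2 y)) => /negbTE.
Qed.

Lemma built_join A E f i j : i != j -> built A E f ->
  built A (fun x y => [|| E x y, (f x == i) && (f y == j)
                       | (f x == j) && (f y == i)]) f.
Proof.
move=> ij [->|[t [g [gI gA gf gE]]]]; first by left.
have rij : enum_rank i != enum_rank j by rewrite (inj_eq enum_rank_inj).
right; exists (CWJoin rij t), g; split=> // x y.
by rewrite [LHS]/= /join_adj gE !gf !(inj_eq enum_rank_inj).
Qed.

Lemma built_joins A E f i (s : seq L) : i \notin s -> built A E f ->
  built A (fun x y => [|| E x y, (f x == i) && (f y \in s)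
                       | (f x \in s) && (f y == i)]) f.
Proof.
elim: s => [|j s IH].
  by move=> _ bA; apply: (built_eq bA) => // x y _ _; rewrite !in_nil andbF orbF.
rewrite inE negb_or => /andP [ij /IH{}IH] /IH /(built_join ij).
move=> bj; apply: (built_eq bj) => // x y _ _; rewrite !inE andb_orr andb_orl.
rewrite -!orbA; congr (_ || _).
by do 4!case: (_ && _).
Qed.

Lemma built_relabel A E f i j : built A E f ->
  built A E (fun x => if f x == i then j else f x).
Proof.
move=> [->|[t [g [gI gA gf gE]]]]; first by left.
right; exists (CWRelabel (enum_rank i) (enum_rank j) t), g; split=> // x /=.
by rewrite gf (inj_eq enum_rank_inj); case: ifP.
Qed.

(* h retracts its non-fixed points, so performing the relabellings one after the
   other never moves a label twice. *)
Lemma built_relabels A E f (h : L -> L) :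
  (forall l, h (h l) = h l) -> built A E f -> built A E (h \o f).
Proof.
move=> hh bf.
suff rec (s : seq L) : built A E (fun x => if f x \in s then h (f x) else f x).
  by apply: (built_eq (rec (enum L))) => // x _ /=; rewrite mem_enum.
elim: s => [//|i s IH].
have := built_relabel i (h i) IH => bi; apply: (built_eq bi) => // x _.
rewrite inE; case: (eqVneq (f x) i) => [->|fi] /=.
  by case: (i \in s); rewrite ?eqxx ?if_same.
case: (f x \in s); last by rewrite (negbTE fi).
by case: eqP => // <-; rewrite hh.
Qed.

Lemma built_constructible f : built [set: G] (@adj G) f ->
  cw_constructible G #|L|.
Proof.
case=> [G0|[t [g [gI gA _ gE]]]]; first by left; rewrite -cardsT G0 cards0.
right; exists t, g; split=> //.
apply: inj_card_bij => //; rewrite -(card_codom gI) subset_leq_card //.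
by apply/subsetP=> v _; have [x <-] := (gA v).1 (in_setT v); exact: codom_f.
Qed.
End Built.

Lemma cw_le (G : sgraph) k : cw_constructible G k -> cw G <= k.
Proof.
by move=> Gk; rewrite /cw; case: ex_minnP => j _; apply; exact/asboolP.
Qed.

(** * Graphs whose vertices are added layer by layer *)

Section Layered.
Variables (G : sgraph) (L : finType) (r : G -> nat) (c : G -> L).
Variable M : bool -> L -> L -> bool.
Hypothesis adjM : forall x y, x != y -> r x <= r y ->
  adj x y = M (r x == r y) (c x) (c y).

(* The vertices are added by increasing r; Some (b, l) labels those of colour l,
   with b true for those of the current layer, and None the vertex just created. *)
Lemma layered_cw : cw G <= #|{: option (bool * L)}|.
Proof.
apply: cw_le.
pose old (o : option (bool * L)) := omap (fun p => (false, p.2)) o.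
pose lab n x := Some (r x == n, c x).
(* The invariant is stated for every [n] not below the ranks, so that the layer of the next vertex
   can be made current before that vertex is added. *)
suff rec s : sorted (relpre r leq) s -> uniq s ->
    forall n, {in s, forall x, r x <= n} ->
    built [set x in s] (@adj G) (lab n).
  have total_r : total (relpre r leq) by move=> x y; exact: leq_total.
  pose s := sort (relpre r leq) (enum G).
  have := rec s (sort_sorted total_r _); rewrite sort_uniq enum_uniq => /(_ isT).
  move=> /(_ (\max_x r x)) bs.
  apply: (@built_constructible _ _ (lab (\max_x r x))).
  suff <- : [set x in s] = [set: G] by apply: bs => x _; exact: leq_bigmax.
  by apply/setP=> x; rewrite !inE mem_sort mem_enum.
elim/last_ind: s => [|s v IH] srt unq n rn.
  by left; apply/setP=> x; rewrite !inE.
have trans_r : transitive (relpre r leq) by move=> x y z; exact: leq_trans.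
move: srt unq; rewrite (sorted_pairwise trans_r) pairwise_rcons.
case/andP=> /allP /= rs; rewrite -(sorted_pairwise trans_r) rcons_uniq.
move=> /IH{}IH /andP [vs /IH{}IH]; have {IH} bs := IH _ rs.
(* First [v] is isolated and alone in having label [None]; then it is joined to the labels in [nv],
   and finally it gets the label of its colour. *)
pose A := [set x in s]; pose E0 x y := [&& adj x y, x != v & y != v].
pose f0 x := if x == v then None else lab (r v) x.
have sv x : x \in s -> x != v by apply: contraTneq => ->.
have b0 : built (A :|: [set v]) E0 f0.
  apply: builtU; last by apply: built1; rewrite /E0 eqxx andbF.
  - by rewrite disjoint_sym disjoints1 inE.
  - by move=> x y _; rewrite inE => /eqP ->; rewrite /E0 eqxx !andbF.
  - apply: (built_eq bs) => [x|x y]; rewrite !inE => xs; rewrite /f0 /E0.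
      by rewrite (negbTE (sv _ xs)).
    by move=> ys; rewrite !sv ?andbT.
pose nv := [seq l <- enum {: option (bool * L)} |
             if l is Some (b, q) then M b q (c v) else false].
have nvNone : None \notin nv by rewrite mem_filter.
have nvE x : x \in s -> (f0 x \in nv) = adj x v.
  move=> xs; rewrite mem_filter mem_enum andbT /f0 (negbTE (sv _ xs)) /=.
  by rewrite -adjM ?sv // rs.
have b1 : built (A :|: [set v]) (@adj G) f0.
  have bj := built_joins nvNone b0; apply: (built_eq bj) => // x y.
  have f0v : f0 v = None by rewrite /f0 eqxx.
  have f0s z : z \in s -> (f0 z == None) = false.
    by move=> /sv zv; rewrite /f0 (negbTE zv).
  rewrite /A !inE /E0 => /orP [xs|/eqP ->] /orP [ys|/eqP ->].
  - by rewrite !sv // !f0s // !andbT andbF !orbF.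
  - by rewrite eqxx !andbF (nvE x) // (f0s x) // f0v /= andbT.
  - by rewrite eqxx /= andbF (nvE y) // (f0s y) // f0v /= andbF orbF adj_sym.
  - by rewrite f0v (negbTE nvNone) adj_irr !andbF.
have {b0 b1} b2 : built [set x in rcons s v] (@adj G) (lab (r v)).
  have -> : [set x in rcons s v] = A :|: [set v].
    by apply/setP=> x; rewrite /A !inE mem_rcons inE orbC.
  have bi := built_relabel None (Some (true, c v)) b1; apply: (built_eq bi) => // x _.
  by rewrite /f0 /lab; case: (eqVneq x v) => [->|//]; rewrite !eqxx.
(* If [n] exceeds the rank of [v], no vertex lies in layer [n] yet and [old] is applied to all
   labels. *)
have := rn v; rewrite mem_rcons mem_head leq_eqVlt => /(_ isT) /predU1P [<- //|vn].
have oldK l : old (old l) = old l by case: l.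
apply: (built_eq (built_relabels oldK b2)) => // x; rewrite inE mem_rcons inE => xs.
rewrite /= /lab; suff /ltn_eqF -> : r x < n by [].
by apply: leq_ltn_trans vn; case/predU1P: xs => [->|/rs].
Qed.
End Layered.

Section LayeredUpTo.
Variables (G : sgraph) (X : {set G}) (L : finType) (r : G -> nat) (c : G -> L).
Variable M : bool -> L -> L -> bool.
Hypothesis adjM : {in ~: X &, forall x y, x != y -> r x <= r y ->
  adj x y = M (r x == r y) (c x) (c y)}.

(** The number of labels when [l] colours are refined by the neighbourhood in a set of [n] vertices,
    each of which gets a colour of its own. *)
Definition layered_bound (l n : nat) := (2 * (l * 2 ^ n + n)).+1.

Lemma layered_cw_up_to : cw G <= layered_bound #|L| #|X|.
Proof.
pose T := {x : G | x \in X}.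
pose c' x : L * {set T} + T :=
  if insub x is Some u then inr u else inl (c x, [set u : T | adj x (val u)]).
pose M' b (p q : L * {set T} + T) := match p, q with
  | inl (l, _), inl (m, _) => M b l m
  | inl (_, N), inr u | inr u, inl (_, N) => u \in N
  | inr u, inr w => adj (val u) (val w)
  end.
apply: leq_trans (@layered_cw G _ r c' M' _) _.
  move=> x y xy rxy; rewrite /c'.
  case: insubP => [u _ <-|xX]; case: insubP => [w _ <-|yX] //=; rewrite ?inE //.
    exact: adj_sym.
  by apply: adjM; rewrite ?inE.
by rewrite card_option card_prod card_bool card_sum card_prod card_set_of card_sig.
Qed.
End LayeredUpTo.

Lemma leq_layered_bound l n1 n2 :
  n1 <= n2 -> layered_bound l n1 <= layered_bound l n2.
Proof.
move=> n12; rewrite ltnS leq_mul2l /= leq_add // leq_mul2l leq_pexp2l ?orbT //.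
Qed.

(** * Atoms *)

(** Deleting the clique [K] leaves a connected graph, and a path in it from [x] to [y] has to leave
    [D]. *)
Lemma atom_separation (G : sgraph) (D K : {set G}) (x y : G) :
  atom G -> clique K -> [disjoint D & K] -> x \in D -> y \notin D -> y \notin K ->
  exists u v, [/\ u \in D, v \notin D, v \notin K & adj u v].
Proof.
move=> atomG cK DK xD yD yK; apply: contrapT => nex; apply: atomG.
exists K; split=> // conn.
have xK : x \in ~: K by rewrite inE (disjointFr DK).
have yK' : y \in ~: K by rewrite inE.
have /connectP [p] := conn (exist _ x xK) (exist _ y yK').
have : val (exist _ x xK : induced (~: K)) \in D by [].
elim: p (exist _ x xK) => [|[w wK] p IH] [u uK] /= uD.
  by move=> _ [e]; move: yD; rewrite e uD.
case/andP=> uw; have {}uw : adj u w := uw; apply: IH => /=; apply: contrapT => /negP wD.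
by apply: nex; exists u, w; split=> //; rewrite inE in wK.
Qed.

Lemma nonclique (G : sgraph) (K : {set G}) : ~ clique K ->
  exists p q, [/\ p \in K, q \in K, p != q & ~~ adj p q].
Proof.
move=> nK; apply: contrapT => nex; apply: nK => p q pK qK pq.
by apply: contrapT => /negP npq; apply: nex; exists p, q.
Qed.

(** If the neighbourhood of [x] were a clique, [atom_separation] for [[set x]] would give an edge
    from [x] to a non-neighbour. *)
Lemma atom_nbhd (G : sgraph) (x y : G) :
  atom G -> x != y -> ~~ adj x y ->
  exists p q, [/\ adj x p, adj x q, p != q & ~~ adj p q].
Proof.
move=> atomG xy nxy; have [cK|/nonclique] := pselect (clique [set z | adj x z]).
  have [||||u [v []]] := @atom_separation G [set x] _ x y atomG cK.
  - by rewrite disjoints1 inE adj_irr.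
  - by rewrite inE.
  - by rewrite inE eq_sym.
  - by rewrite inE.
  - by rewrite !inE => /eqP -> _ /negbTE ->.
by move=> [p [q []]]; rewrite !inE => *; exists p, q.
Qed.

Definition is_C4 (G : sgraph) (a b c d : G) :=
  [&& adj a b, adj b c, adj c d, adj d a, ~~ adj a c, ~~ adj b d, a != c & b != d].

Definition is_C5 (G : sgraph) (a b c d e : G) :=
  [&& [&& adj a b, adj b c, adj c d, adj d e & adj e a],
      ~~ adj a c, ~~ adj b d, ~~ adj c e & ~~ adj d a && ~~ adj e b].

(** * Consequences of excluding the two subgraphs *)

Section Free.
Variable G : sgraph.
Implicit Types a b c d u v w x y z p q s t : G.
Hypothesis no_2K2 : forall a b c d, ~~ is_2K2 a b c d.
Hypothesis no_coP2P3 : forall a b x y z, ~~ is_coP2P3 a b x y z.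

Lemma edge_meets a b c d : adj a b -> adj c d ->
  [|| adj a c, adj a d, adj b c | adj b d].
Proof.
move=> ab cd; apply: contraNT (no_2K2 a b c d).
by rewrite !negb_or /is_2K2 ab cd.
Qed.

Lemma nonadj_trans a b y x z : a != b -> ~~ adj a b ->
  adj a x -> adj a y -> adj a z -> adj b x -> adj b y -> adj b z ->
  ~~ adj x y -> ~~ adj y z -> ~~ adj x z.
Proof.
move=> aNb ab ax ay az bx b_y bz xy yz; apply: contra (no_coP2P3 a b x y z) => xz.
by rewrite /is_coP2P3 aNb ab ax ay az bx b_y bz xy yz.
Qed.

Lemma atom_C4_or_C5 b w : atom G -> b != w -> ~~ adj b w ->
  (exists a b c d, is_C4 a b c d) \/ (exists a b c d e, is_C5 a b c d e).
Proof.
move=> atomG bw nbw.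
pose D := [set y | (y != b) && ~~ adj b y].
pose S := [set x | adj b x & [exists y in D, adj x y]].
have nS : ~ clique S.
  move=> cS; have [||||u [v []]] := @atom_separation G D S w b atomG cS.
  - by apply/pred0P=> x; rewrite /= !inE; case: (adj b x); rewrite ?andbF.
  - by rewrite inE eq_sym bw.
  - by rewrite inE eqxx.
  - by rewrite inE adj_irr.
  rewrite !inE negb_and !negbK => /andP [ub nbu] vD vS uv.
  have bv : adj b v.
    by case/predU1P: vD uv nbu => // ->; rewrite adj_sym => ->.
  move: vS; rewrite bv => /negP; apply; apply/existsP; exists u.
  by rewrite !inE ub nbu adj_sym.
have [x [y []]] := nonclique nS; rewrite !inE.
case/andP=> bx /existsP [d1 /andP []]; rewrite inE => /andP [d1b bd1] xd1.
case/andP=> b_y /existsP [d2 /andP []]; rewrite inE => /andP [d2b bd2] yd2 xy nxy.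
(* A common neighbour among [d1], [d2] closes a C_4. Otherwise the edges from [x] to [d1] and from
   [y] to [d2] can only meet in an edge between [d1] and [d2], which closes a C_5. *)
have [xd2|xd2] := boolP (adj x d2).
  left; exists b, x, d2, y; rewrite /is_C4 bx xd2 bd2 nxy xy.
  by rewrite [adj d2 y]adj_sym yd2 [adj y b]adj_sym b_y eq_sym d2b.
have [yd1|yd1] := boolP (adj y d1).
  left; exists b, x, d1, y; rewrite /is_C4 bx xd1 bd1 nxy xy.
  by rewrite [adj d1 y]adj_sym yd1 [adj y b]adj_sym b_y eq_sym d1b.
right; exists b, x, d1, d2, y; rewrite /is_C5 bx xd1 bd1 xd2.
have := edge_meets xd1 yd2; rewrite (negbTE nxy) (negbTE xd2) [adj d1 y]adj_sym.
rewrite (negbTE yd1) /= => ->; rewrite [adj d2 y]adj_sym yd2 [adj y b]adj_sym b_y.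
by rewrite [adj d2 b]adj_sym bd2 [adj y x]adj_sym nxy.
Qed.


(** * Atoms with an induced C_4 but no induced C_5 *)

Lemma is_C4_swap a b c d : is_C4 a b c d -> is_C4 b a d c.
Proof.
case/and5P=> ab bc cd da /and4P [ac bd aNc bNd].
by apply/and5P; split; [..|apply/and4P; split] => //; rewrite adj_sym.
Qed.

(** In a C_4 with vertices [a], [b], [c], [d] this set contains [b] and [d], and by [C4_side_d] its
    members miss [d] as well. *)
Definition C4_side a b c := [set x | [&& adj x a, adj x c & ~~ adj x b]].
Definition C4_hub a b c d := [set x | (adj x a && adj x c) && (adj x b && adj x d)].
Definition C4_rest a b c d :=
  [set x | ~~ (adj x a && adj x c) && ~~ (adj x b && adj x d)].

Section C4.
Variables a b c d : G.
Hypothesis abcd : is_C4 a b c d.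

Let ab : adj a b. Proof. by case/and5P: abcd. Qed.
Let bc : adj b c. Proof. by case/and5P: abcd. Qed.
Let cd : adj c d. Proof. by case/and5P: abcd. Qed.
Let da : adj d a. Proof. by case/and5P: abcd. Qed.
Let nac : ~~ adj a c. Proof. by case/and5P: abcd => _ _ _ _ /and4P []. Qed.
Let nbd : ~~ adj b d. Proof. by case/and5P: abcd => _ _ _ _ /and4P []. Qed.
Let ac : a != c. Proof. by case/and5P: abcd => _ _ _ _ /and4P []. Qed.
Let bd : b != d. Proof. by case/and5P: abcd => _ _ _ _ /and4P []. Qed.

Lemma C4_common_trans y x z :
  adj x a && adj x c -> adj y a && adj y c -> adj z a && adj z c ->
  ~~ adj x y -> ~~ adj y z -> ~~ adj x z.
Proof.
move=> /andP [xa xc] /andP [ya yc] /andP [za zc].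
by apply: (nonadj_trans ac nac); rewrite // adj_sym.
Qed.

(** Non-adjacency is an equivalence on the common neighbours of [a] and [c]; the side is the class
    of [b], which contains [d]. *)
Lemma C4_side_d x : x \in C4_side a b c -> ~~ adj x d.
Proof.
rewrite inE => /and3P [xa xc xb].
by apply: (@C4_common_trans b) => //; apply/andP; split=> //; rewrite adj_sym.
Qed.

Lemma C4_side_indep x y :
  x \in C4_side a b c -> y \in C4_side a b c -> ~~ adj x y.
Proof.
rewrite !inE => /and3P [xa xc xb] /and3P [ya yc yb].
by apply: (@C4_common_trans b); rewrite ?xa ?ya ?ab ?bc // adj_sym // ab.
Qed.

Lemma C4_side_hub x u : x \in C4_side a b c -> u \in C4_hub a b c d -> adj x u.
Proof.
rewrite !inE => /and3P [xa xc xb] /andP [uac /andP [ub ud]].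
apply: contraTT ub => xu; apply: (@C4_common_trans x) => //.
- by rewrite xa.
- by rewrite [adj b a]adj_sym ab.
- by rewrite adj_sym.
Qed.

Lemma C4_hub_trans v u w : u \in C4_hub a b c d -> v \in C4_hub a b c d ->
  w \in C4_hub a b c d -> ~~ adj u v -> ~~ adj v w -> ~~ adj u w.
Proof.
by rewrite !inE => /andP [u1 _] /andP [v1 _] /andP [w1 _]; exact: C4_common_trans.
Qed.

End C4.

(** Without 2P_2 the neighbourhoods of the vertices of [X] are nested. So [X] is ordered by
    decreasing degree, and a vertex of [Y] takes the largest rank of its neighbours. *)
Lemma chain_rank (X Y : {set G}) :
  {in X &, forall x y, ~~ adj x y} -> {in Y &, forall x y, ~~ adj x y} ->
  [disjoint X & Y] ->
  exists rk : G -> nat, {in X & Y, forall x y, adj x y = (rk x <= rk y)}.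
Proof.
move=> iX iY dXY; pose deg x := #|[set y in Y | adj x y]|.
pose rk x := if x \in X then #|G| - deg x else
  \max_(z in X | adj z x) (#|G| - deg z).
exists rk => x y xX yY; rewrite /rk xX (disjointFl dXY yY).
have degG z : deg z <= #|G| by exact: max_card.
apply/idP/idP => [xy|]; first by apply: (bigmax_sup x); rewrite ?xX.
apply: contraTT => nxy; rewrite -ltnNge.
have lt_deg z : z \in X -> adj z y -> deg x < deg z.
  move=> zX zy; apply: proper_card; apply/properP; split; last first.
    by exists y; rewrite !inE yY // (negbTE nxy).
  apply/subsetP=> t; rewrite !inE => /andP [tY xt]; rewrite tY /=.
  have := edge_meets zy xt; rewrite [adj y x]adj_sym (negbTE nxy).
  by rewrite (negbTE (iX _ _ zX xX)) (negbTE (iY _ _ yY tY)) /= orbF.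
(* This covers a [y] without neighbours in [X], whose maximum is 0. *)
have degx : deg x < #|G|.
  rewrite -cardsT; apply: proper_card; rewrite properT; apply/eqP=> /setP /(_ y).
  by rewrite !inE yY (negbTE nxy).
rewrite -[X in _ < X]prednK ?subn_gt0 // ltnS; apply/bigmax_leqP => z /andP [zX zy].
by have := lt_deg z zX zy; have := degG z; lia.
Qed.

(** Non-adjacency is an equivalence on [U]; the rank is the position of the first member of the
    class in the enumeration. *)
Lemma multipartite_rank (U : {set G}) :
  {in U & &, forall x y z, ~~ adj x y -> ~~ adj y z -> ~~ adj x z} ->
  exists rk : G -> nat, (forall x, rk x <= #|G|) /\
    {in U &, forall x y, adj x y = (rk x != rk y)}.
Proof.
move=> tU; pose far x y := (y \in U) && ~~ adj x y.
exists (fun x => find (far x) (enum G)); split=> [x|x y xU yU].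
  by rewrite cardE find_size.
have has_far z : z \in U -> has (far z) (enum G).
  move=> zU; apply/hasP; exists z; rewrite ?mem_enum //.
  by rewrite /far zU adj_irr.
apply/idP/idP => [xy|]; last first.
  apply: contraNT => nxy; apply/eqP/eq_find => z; rewrite /far.
  case zU: (z \in U) => //=; apply/idP/idP; last exact: tU.
  by apply: tU => //; rewrite adj_sym.
apply/eqP=> e; move: xy; apply/negP.
have := nth_find x (has_far _ xU); rewrite e => /andP [wU xw].
have := nth_find x (has_far _ yU) => /andP [_ yw].
by apply: tU xw _ => //; rewrite adj_sym.
Qed.

(** The classes of [U] come first, one per layer, then [X] and [Y] in chain order: a vertex of [X]
    sees the vertices of [Y] from its own layer on. *)
Lemma chain_join_cw (E U X Y : {set G}) :
  {in X &, forall x y, ~~ adj x y} -> {in Y &, forall x y, ~~ adj x y} ->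
  {in U & &, forall x y z, ~~ adj x y -> ~~ adj y z -> ~~ adj x z} ->
  {in U & X :|: Y, forall u x, adj u x} ->
  [disjoint X & Y] -> [disjoint U & X :|: Y] ->
  (forall x, [|| x \in E, x \in U | x \in X :|: Y]) ->
  cw G <= layered_bound #|{: option bool}| #|E|.
Proof.
move=> iX iY tU UXY dXY dU cover.
have [rkXY adjXY] := chain_rank iX iY dXY.
have [rkU [rkUG adjU]] := multipartite_rank tU.
(* The offset puts the chain after all classes of [U], whose ranks are at most [#|G|]. *)
pose r x := if x \in U then rkU x else #|G|.+1 + rkXY x.
pose col x := if x \in U then None else Some (x \in Y).
pose M (b : bool) (p q : option bool) := match p, q with
  | None, None => ~~ b
  | None, _ | _, None => true
  | Some false, Some true => true
  | Some true, Some false => b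
  | _, _ => false
  end.
apply: (@layered_cw_up_to _ E _ r col M) => x y; rewrite !inE => xE yE xy.
have side z : z \notin E -> z \notin U -> z \in X :|: Y /\ (z \in Y) = (z \notin X).
  move=> zE zU; have := cover z; rewrite (negbTE zE) (negbTE zU) /= => zXY.
  split=> //; have [zX|zX] := boolP (z \in X); first by rewrite (disjointFr dXY).
  by move: zXY; rewrite inE (negbTE zX).
rewrite /r /col; case: ifP => xU; case: ifP => yU rxy /=.
- by rewrite adjU.
- by rewrite UXY //; case: (side y yE (negbT yU)).
- by move: rxy; have := rkUG y; lia.
have [_ xY] := side x xE (negbT xU); have [_ yY] := side y yE (negbT yU).
move: rxy; rewrite leq_add2l eqn_add2l xY yY.
have [xX|xX] := boolP (x \in X); have [yX|yX] := boolP (y \in X) => /= rxy.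
- by apply/negbTE/iX.
- by rewrite adjXY // yY.
- by rewrite adj_sym adjXY ?xY // eqn_leq rxy.
- by apply/negbTE/iY; rewrite ?xY ?yY.
Qed.

(** * The vertices outside the hub and the sides of a C_4, without induced C_5 *)

Section C4Cases.
Variables a b c d : G.
Hypothesis abcd : is_C4 a b c d.
Hypothesis no_C5 : forall a b c d e, ~~ is_C5 a b c d e.
Let badc := is_C4_swap abcd.

Let ab : adj a b. Proof. by case/and5P: abcd. Qed.
Let bc : adj b c. Proof. by case/and5P: abcd. Qed.
Let cd : adj c d. Proof. by case/and5P: abcd. Qed.
Let da : adj d a. Proof. by case/and5P: abcd. Qed.
Let nac : ~~ adj a c. Proof. by case/and5P: abcd => _ _ _ _ /and4P []. Qed.
Let nbd : ~~ adj b d. Proof. by case/and5P: abcd => _ _ _ _ /and4P []. Qed.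

Let S0 := C4_side a b c.
Let S1 := C4_side b a d.
Let U := C4_hub a b c d.
Let I := C4_rest a b c d.

Let S0_d x : x \in S0 -> ~~ adj x d. Proof. exact: C4_side_d. Qed.
Let S1_c x : x \in S1 -> ~~ adj x c. Proof. exact: C4_side_d. Qed.

Lemma C4_hubC : C4_hub b a d c = U.
Proof. by apply/setP=> x; rewrite !inE andbC. Qed.

Lemma C4_restC : C4_rest b a d c = I.
Proof. by apply/setP=> x; rewrite !inE andbC. Qed.

Lemma C4_cover x : [|| x \in U, x \in S0, x \in S1 | x \in I].
Proof.
rewrite !inE; case xac: (adj x a && adj x c).
  have := C4_common_trans abcd (y := d) (x := x) (z := b) xac.
  rewrite [adj b a]adj_sym ab bc da [adj d c]adj_sym cd [adj d b]adj_sym nbd.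
  case/andP: xac => -> -> /(_ isT isT) /=.
  by case: (adj x b); case: (adj x d) => //= /(_ isT isT).
case xbd: (adj x b && adj x d); last by rewrite !orbT.
have := C4_common_trans badc (y := c) (x := x) (z := a) xbd.
rewrite [adj c b]adj_sym ab bc [adj a d]adj_sym da cd [adj c a]adj_sym nac.
case/andP: xbd xac => -> -> + /(_ isT isT) /=.
by case: (adj x a); case: (adj x c) => //= _ /(_ isT isT).
Qed.

(* Closing an induced path u - v - w by an edge xy would give an induced C_5. *)
Lemma no_closed_path u v w x y : adj u v -> adj v w -> ~~ adj u w -> adj x y ->
  ~~ [&& adj x u, adj y w, ~~ adj x v, ~~ adj x w, ~~ adj y u & ~~ adj y v].
Proof.
move=> uv vw uw xy; apply: contra (no_C5 x u v w y).
case/and5P=> xu yw xv xw /andP [yu yv]; rewrite /is_C5 xu uv vw uw xv.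
by rewrite [adj w y]adj_sym yw [adj y x]adj_sym xy [adj v y]adj_sym yv
  [adj w x]adj_sym xw yu.
Qed.

(** The edge meets all four edges of the cycle and closes none of its induced paths; this leaves
    only the case where [x] and [y] see exactly the ends of two opposite edges of the cycle. *)
Lemma C4_rest_edge x y : x \in I -> y \in I -> adj x y ->
  [/\ adj x c = ~~ adj x a, adj x d = ~~ adj x b,
      adj y a = adj x c, adj y c = adj x a & adj y b = adj x d /\ adj y d = adj x b].
Proof.
rewrite !inE => xI yI xy; move: xI yI.
have ca : ~~ adj c a by rewrite adj_sym.
have db : ~~ adj d b by rewrite adj_sym.
have ba : adj b a by rewrite adj_sym.
have cb : adj c b by rewrite adj_sym.
have dc : adj d c by rewrite adj_sym.
have ad : adj a d by rewrite adj_sym.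
move: (edge_meets xy ab) (edge_meets xy bc) (edge_meets xy cd) (edge_meets xy da).
move: (no_closed_path ab bc nac xy) (no_closed_path ad dc nac xy).
move: (no_closed_path cb ba ca xy) (no_closed_path cd da ca xy).
move: (no_closed_path bc cd nbd xy) (no_closed_path ba ad nbd xy).
move: (no_closed_path da ab db xy) (no_closed_path dc cb db xy).
by case: (adj x a); case: (adj x b); case: (adj x c); case: (adj x d) => //=;
  case: (adj y a); case: (adj y b); case: (adj y c); case: (adj y d).
Qed.
Let E := [set x in I | [exists y in I, adj x y]].

(** Two vertices of [E] seeing the same edge of the cycle would share a neighbour [y] in the rest
    and form the complement of P_2 + P_3 with [y] and that edge. *)
Lemma card_C4_rest_edges : #|E| <= 4.
Proof.
have -> : 4 = #|{: bool * bool}| by rewrite card_prod card_bool.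
pose f x := (adj x a, adj x b); suff fI : {in E &, injective f}.
  by rewrite -(card_in_imset fI) max_card.
move=> x x' /setIdP [xI /existsP [y /andP [yI xy]]].
case/setIdP=> x'I /existsP [y' /andP [y'I xy']] [ea eb].
have [xc xd ya yc [yb yd]] := C4_rest_edge xI yI xy.
have [x'c x'd _ _ _] := C4_rest_edge x'I y'I xy'.
apply/eqP; apply: contraT => xx'.
have nxx' : ~~ adj x x'.
  apply/negP=> /(C4_rest_edge xI x'I) [+ _ + _ _].
  by rewrite -ea => ->; case: (adj x a).
have [p [q [xp xq yp yq pq]]] : exists p q,
    [/\ adj x p && adj x' p, adj x q && adj x' q, ~~ adj y p, ~~ adj y q & adj p q].
  exists (if adj x a then a else c), (if adj x b then b else d).
  case xa: (adj x a); case xb: (adj x b);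
    rewrite ?xa ?xb ?xc ?xd ?x'c ?x'd -?ea -?eb ?ya ?yb ?yc ?yd ?xc ?xd ?xa ?xb;
    rewrite ?ab ?cd //.
    by rewrite adj_sym da.
  by rewrite adj_sym bc.
case/andP: xp => xp x'p; case/andP: xq => xq x'q.
(* Of [a] and [c], [t] is the one seen by [x'] and [s] the one seen by [y]; these two edges can only
   meet between [x'] and [y]. *)
have x'y : adj x' y.
  have [t [s [x't ys ts xs yt]]] : exists t s,
    [/\ adj x' t, adj y s, ~~ adj t s, ~~ adj x' s & ~~ adj t y].
    exists (if adj x a then a else c), (if adj x a then c else a).
    case xa: (adj x a); rewrite ?x'c -?ea ?xa ?yc ?ya ?xc ?xa ?nac //.
      by rewrite adj_sym ya xc xa.
    by rewrite [adj c a]adj_sym nac [adj c y]adj_sym yc xa.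
  have := edge_meets x't ys.
  by rewrite (negbTE ts) (negbTE xs) (negbTE yt) !orbF.
have := no_coP2P3 x x' p y q; rewrite /is_coP2P3 xx' nxx' xp xy xq x'p x'y x'q.
by rewrite [adj p y]adj_sym yp yq pq.
Qed.

(** Since [x] misses some [u] among [a], [c] and some [v] among [b], [d], the cycle through [x],
    [p], [u], [v], [s] would otherwise be an induced C_5. *)
Lemma C4_rest_sides x p s : x \in I -> p \in S0 -> s \in S1 -> adj x p ->
  adj x s -> adj p s.
Proof.
move=> xI pS sS xp xs; have pd := S0_d pS; have sc := S1_c sS.
move: xI pS sS; rewrite !inE !negb_and => xI /and3P [pa pc pb] /and3P [sb sd sa].
apply: contraT => ps.
have [u [v]] : exists u v, [&& adj p u, adj u v, adj v s, ~~ adj x u, ~~ adj x v,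
    ~~ adj p v & ~~ adj u s].
  case/andP: xI => /orP [xa|xc] /orP [xb|xd].
  - by exists a, b; rewrite pa ab [adj b s]adj_sym sb xa xb pb [adj a s]adj_sym.
  - by exists a, d; rewrite pa [adj a d]adj_sym da [adj d s]adj_sym sd xa xd pd adj_sym.
  - by exists c, b; rewrite pc [adj c b]adj_sym bc [adj b s]adj_sym sb xc xb pb adj_sym.
  - by exists c, d; rewrite pc cd [adj d s]adj_sym sd xc xd pd adj_sym.
case/and5P=> pu uv vs xu /and3P [xv pv us].
have := no_C5 x p u v s; rewrite /is_C5 xp pu uv vs [adj s x]adj_sym xs xu pv us.
by rewrite [adj v x]adj_sym xv [adj s p]adj_sym ps.
Qed.

(** Some edge of the cycle has both ends missed by [x]; with it and [x], non-adjacent [u] and [v]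
    would form the complement of P_2 + P_3. *)
Lemma C4_rest_hub x u v : x \in I -> u \in U -> v \in U -> adj x u -> adj x v ->
  u != v -> adj u v.
Proof.
move=> xI uU vU xu xv uv; apply: contraT => nuv.
move: xI uU vU; rewrite !inE !negb_and.
move=> xI /andP [/andP [ua uc] /andP [ub ud]] /andP [/andP [va vc] /andP [vb vd]].
have out p q : adj p q -> adj u p -> adj u q -> adj v p -> adj v q ->
    ~~ adj x p -> adj x q.
  move=> pq up uq vp vq xp; apply: contraT => xq.
  have := no_coP2P3 u v p x q; rewrite /is_coP2P3 uv nuv up uq vp vq pq xq.
  by rewrite [adj u x]adj_sym [adj v x]adj_sym xu xv [adj p x]adj_sym xp.
case/andP: xI => /orP [xa|xc] /orP [].
- by rewrite (out a b).
- by rewrite (out a d) // adj_sym.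
- by rewrite (out c b) // adj_sym.
- by rewrite (out c d).
Qed.

(** Among the common neighbours of [p] and [q], [x] is in the non-adjacency class of [a]. Hub
    vertices see [a], hence [x]; a neighbour of [x] in [S1] would be such a common neighbour by
    [C4_rest_sides], but misses [a]. *)
Lemma C4_rest_pair x p q : x \in I -> p \in S0 -> q \in S0 -> p != q ->
  adj x p -> adj x q -> {in U, forall u, adj x u} /\ {in S1, forall s, ~~ adj x s}.
Proof.
move=> xI pS qS pq xp xq; have npq := C4_side_indep abcd pS qS.
have tr u v w : adj p u -> adj p v -> adj p w -> adj q u -> adj q v -> adj q w ->
  ~~ adj u v -> ~~ adj v w -> ~~ adj u w := @nonadj_trans p q v u w pq npq.
have px : adj p x by rewrite adj_sym.
have qx : adj q x by rewrite adj_sym.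
have [] : [/\ adj p a, adj p c, adj q a & adj q c].
  by move: pS qS; rewrite !inE => /and3P [-> -> _] /and3P [-> ->].
move=> pa pc qa qc; have nca : ~~ adj c a by rewrite adj_sym.
have [xa xc] : ~~ adj x a /\ ~~ adj x c.
  move: xI; rewrite inE negb_and => /andP [/orP [xa|xc] _].
    by split=> //; apply: (tr x a c).
  by split=> //; apply: (tr x c a).
split=> [u uU|s sS].
  have pu := C4_side_hub abcd pS uU; have qu := C4_side_hub abcd qS uU.
  apply: contraT => xu; suff : ~~ adj a u.
    by move: uU; rewrite inE [adj a u]adj_sym => /andP [/andP [->]].
  by apply: (tr a x u) => //; rewrite adj_sym.
apply/negP=> xs; have ps := C4_rest_sides xI pS sS xp xs.
have qs := C4_rest_sides xI qS sS xq xs; move: xs; apply/negP.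
apply: (tr x a s) => //; move: sS; rewrite !inE => /and3P [_ _].
by rewrite adj_sym.
Qed.
End C4Cases.

Lemma atom_C4_cw a b c d :
  atom G -> is_C4 a b c d -> (forall a b c d e, ~~ is_C5 a b c d e) ->
  cw G <= layered_bound #|{: option bool}| 4.
Proof.
move=> atomG abcd no_C5; have badc := is_C4_swap abcd.
pose S0 := C4_side a b c; pose S1 := C4_side b a d.
pose U := C4_hub a b c d; pose I := C4_rest a b c d.
pose E := [set x in I | [exists y in I, adj x y]].
(* Two non-adjacent neighbours of [x] must lie on the same side, all other combinations being
   adjacent; then [C4_rest_pair] applies. *)
have restP x : x \in I -> x \notin E -> {in U, forall u, adj x u} /\
    ({in S1, forall s, ~~ adj x s} \/ {in S0, forall s, ~~ adj x s}).
  move=> xI xE.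
  have xNI y : y \in I -> ~~ adj x y.
    move=> yI; apply: contraNN xE => xy.
    by apply/setIdP; split=> //; apply/existsP; exists y; rewrite yI.
  have [v xv nxv] : exists2 v, x != v & ~~ adj x v.
    have := xI; rewrite inE !negb_and => /andP [/orP [xa|xc] _].
      have [ea|] := eqVneq x a; last by exists a.
      exists c; last by rewrite ea; case/and5P: abcd => _ _ _ _ /and4P [].
      by rewrite ea; case/and5P: abcd => _ _ _ _ /and4P [].
    have [ec|] := eqVneq x c; last by exists c.
    exists a; rewrite ec; case/and5P: abcd => _ _ _ _ /and4P [] //.
      by rewrite eq_sym.
    by rewrite adj_sym.
  have [p [q [xp xq pq npq]]] := atom_nbhd atomG xv nxv.
  have kind z : adj x z -> [|| z \in U, z \in S0 | z \in S1].
    move=> xz; have := C4_cover abcd z; rewrite -/U -/S0 -/S1 -/I.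
    by have [/xNI|_] := boolP (z \in I); rewrite ?xz ?orbF.
  have in0 z t : z \in S0 -> t \in S0 -> z != t -> adj x z -> adj x t ->
      {in U, forall u, adj x u} /\ {in S1, forall s, ~~ adj x s}.
    by move=> zS tS zt xz xt; apply: (C4_rest_pair abcd no_C5 xI zS tS zt).
  have in1 z t : z \in S1 -> t \in S1 -> z != t -> adj x z -> adj x t ->
      {in U, forall u, adj x u} /\ {in S0, forall s, ~~ adj x s}.
    have xI' : x \in C4_rest b a d c by rewrite C4_restC.
    move=> zS tS zt xz xt.
    by have := C4_rest_pair badc no_C5 xI' zS tS zt xz xt; rewrite C4_hubC.
  have US0 u z : u \in U -> z \in S0 -> adj z u.
    by move=> uU zS; apply: (C4_side_hub abcd).
  have US1 u z : u \in U -> z \in S1 -> adj z u.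
    by move=> uU zS; apply: (C4_side_hub badc zS); rewrite C4_hubC.
  have S01 z t : z \in S0 -> t \in S1 -> adj x z -> adj x t -> adj z t.
    exact: (C4_rest_sides abcd no_C5 xI).
  case/or3P: (kind p xp) => pK; case/or3P: (kind q xq) => qK.
  - by move: npq; rewrite (C4_rest_hub abcd xI pK qK).
  - by move: npq; rewrite adj_sym US0.
  - by move: npq; rewrite adj_sym US1.
  - by move: npq; rewrite US0.
  - by have [? ?] := in0 _ _ pK qK pq xp xq; split; [|left].
  - by move: npq; rewrite S01.
  - by move: npq; rewrite US1.
  - by move: npq; rewrite adj_sym S01.
  - by have [? ?] := in1 _ _ pK qK pq xp xq; split; [|right].
(* The non-exceptional rest is split so that each vertex joins a side to which it is
   anticomplete. *)
pose I0 := [set x in I :\: E | [forall s in S1, ~~ adj x s]].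
pose X := S0 :|: ((I :\: E) :\: I0); pose Y := S1 :|: I0.
have I0P x : reflect (x \in I /\ x \notin E /\ {in S1, forall s, ~~ adj x s}) (x \in I0).
  apply: (iffP setIdP) => [[/setDP [xI xE] /forall_inP]|[xI [xE xS]]] //.
  by split; [apply/setDP | apply/forall_inP].
have I1P x : x \in (I :\: E) :\: I0 ->
    [/\ x \in I, x \notin E & {in S0, forall s, ~~ adj x s}].
  case/setDP=> /setDP [xI xE] /I0P xI0; split=> //.
  by case: (restP x xI xE) => _ [xS1|//]; case: xI0.
have II x y : x \in I -> y \in I -> x \notin E -> ~~ adj x y.
  move=> xI yI; apply: contraNN => xy; apply/setIdP; split=> //.
  by apply/existsP; exists y; rewrite yI.
have dUS0 x : x \in U -> x \notin S0.
  by rewrite !inE => /andP [_ /andP [-> _]]; rewrite !andbF.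
have dUS1 x : x \in U -> x \notin S1.
  by rewrite !inE => /andP [/andP [-> _] _]; rewrite !andbF.
have dUI x : x \in U -> x \notin I by rewrite !inE => /andP [->].
have dS0I x : x \in S0 -> x \notin I by rewrite !inE => /and3P [-> ->].
have dS1I x : x \in S1 -> x \notin I.
  by rewrite !inE => /and3P [-> ->]; rewrite andbF.
have dS01 x : x \in S0 -> x \notin S1.
  by rewrite !inE => /and3P [-> _ _]; rewrite !andbF.
apply: leq_trans (@chain_join_cw E U X Y _ _ _ _ _ _ _) _.
- move=> x y; rewrite !in_setU => /orP [xS|/I1P [xI xE xS]] /orP [yS|/I1P [yI yE yS]].
  + exact: (C4_side_indep abcd).
  + by rewrite adj_sym yS.
  + by rewrite xS.
  + exact: II.
- move=> x y; rewrite !in_setU.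
  case/orP=> [xS|/I0P [xI [xE xS]]] /orP [yS|/I0P [yI [yE yS]]].
  + exact: (C4_side_indep badc).
  + by rewrite adj_sym yS.
  + by rewrite xS.
  + exact: II.
- by move=> x y z xU yU zU; apply: (C4_hub_trans abcd).
- move=> u x uU; rewrite !in_setU adj_sym.
  case/orP=> /orP [xS|].
  + exact: (C4_side_hub abcd).
  + by case/I1P=> xI xE _; case: (restP x xI xE) => ->.
  + by apply: (C4_side_hub badc xS); rewrite C4_hubC.
  + by case/I0P=> xI [xE _]; case: (restP x xI xE) => ->.
- apply/pred0P=> x /=; rewrite !in_setU; apply/negP=> /andP [].
  case/orP=> [xS /orP [|/I0P []]|xI /orP []].
  + exact/negP/dS01.
  + by move=> xI; move: (dS0I x xS); rewrite xI.
  + by move=> xS; case/I1P: xI => xI; move: (dS1I x xS); rewrite xI.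
  + by move=> xI0; move: xI; rewrite in_setD xI0.
- apply/pred0P=> x /=; rewrite !in_setU; apply/negP=> /andP [xU].
  case/orP=> /orP [|].
  + exact/negP/dUS0.
  + by case/I1P=> xI; move: (dUI x xU); rewrite xI.
  + exact/negP/dUS1.
  + by case/I0P=> xI; move: (dUI x xU); rewrite xI.
- move=> x; have := C4_cover abcd x; rewrite -/U -/S0 -/S1 -/I.
  rewrite !in_setU !in_setD; case: (x \in E) => //=.
  by case: (x \in U) => //=; case: (x \in S0) => //=; case: (x \in S1);
    rewrite ?orbT //= => ->; case: (x \in I0).
by apply: leq_layered_bound; apply: (card_C4_rest_edges abcd no_C5).
Qed.


(** * Atoms with an induced C_5 *)

Section C5.
(** Periodic indexing by all naturals turns rotations of the cycle into shifts of the index. *)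
Variable v : nat -> G.
Hypothesis v_period : forall i, v (i + 5) = v i.
Hypothesis v_C5 : forall i, is_C5 (v i) (v i.+1) (v i.+2) (v i.+3) (v i.+4).

Lemma C5_adj i : [/\ adj (v i) (v i.+1), ~~ adj (v i) (v i.+2),
  ~~ adj (v i) (v i.+3) & adj (v i) (v i.+4)].
Proof.
case/and5P: (v_C5 i) => /and5P [e01 _ _ _ e40] n02 _ _ /andP [n30 _].
by split=> //; rewrite adj_sym.
Qed.

Lemma C5_periodic5 i : v i.+4.+1 = v i.
Proof. by rewrite -[RHS]v_period addnC. Qed.

Lemma C5_neq2 i : v i != v i.+2.
Proof.
have [a01 _ _ _] := C5_adj i; have [_ _ n14 _] := C5_adj i.+1.
have [a23 _ _ _] := C5_adj i.+2; have [_ _ n30 _] := C5_adj i.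
by apply: contraNneq n30 => ->.
Qed.

(* nonadj_trans for the non-adjacent pair v_i, v_(i+2), whose common neighbours
   include v_(i+1). *)
Lemma C5_common_trans i y x z :
  adj x (v i) && adj x (v i.+2) -> adj y (v i) && adj y (v i.+2) ->
  adj z (v i) && adj z (v i.+2) -> ~~ adj x y -> ~~ adj y z -> ~~ adj x z.
Proof.
move=> /andP [? ?] /andP [? ?] /andP [? ?].
have [_ n _ _] := C5_adj i.
by apply: (nonadj_trans (C5_neq2 i) n); rewrite // adj_sym.
Qed.

Lemma C5_mid i : adj (v i.+1) (v i) && adj (v i.+1) (v i.+2).
Proof.
have [a01 _ _ _] := C5_adj i; have [a12 _ _ _] := C5_adj i.+1.
by rewrite adj_sym a01 a12.
Qed.

Lemma C5_nbr x i : adj x (v i) -> adj x (v i.+2) || adj x (v i.+3).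
Proof.
move=> xi; have [_ n2 n3 _] := C5_adj i; have [a23 _ _ _] := C5_adj i.+2.
by have := edge_meets xi a23; rewrite (negbTE n2) (negbTE n3) !orbF.
Qed.

Lemma C5_edge_cover x z i : (forall j, ~~ adj z (v j)) -> adj x z ->
  adj x (v i) || adj x (v i.+1).
Proof.
move=> zC xz; have [a01 _ _ _] := C5_adj i.
by have := edge_meets xz a01; rewrite !(negbTE (zC _)) !orbF.
Qed.

(** These vertices see [v i] and both ends of the opposite edge but not the whole cycle; the boolean
    selects a missed neighbour of [v i]. *)
Definition C5_B i (b : bool) := [set x | [&& adj x (v i), adj x (v i.+2),
  adj x (v i.+3) & ~~ adj x (v (if b then i.+1 else i.+4))]].

(* The vertices that can replace v_i in the cycle, v_i among them; v_(i+4) plays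
   the role of v_(i-1). *)
Definition C5_S i := [set x | [&& adj x (v i.+4), adj x (v i.+1), ~~ adj x (v i),
  ~~ adj x (v i.+2) & ~~ adj x (v i.+3)]].

(** The vertices that break the twin pattern, as [v i] and [v i.+2] are not adjacent. *)
Definition C5_F i := [set x in C5_S i | [exists y in C5_S i.+2, adj x y]].

Definition C5_exceptional := \bigcup_(i < 5) (C5_B i true :|: C5_B i false :|: C5_F i).

(* Two vertices of C5_B i b would, with v_i, v_(i+2) and v_(i+3), form a complement
   of P_2 + P_3 if they were not adjacent; they are not, as both miss the common
   neighbour of two of these three vertices. *)
Lemma card_C5_B i (b : bool) : #|C5_B i b| <= 1.
Proof.
apply/card_le1P=> x; rewrite inE => /and4P [x0 x2 x3 xm] y; rewrite !inE.
apply/idP/eqP => [/and4P [y0 y2 y3 ym]|->]; last by rewrite x0 x2 x3 xm.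
have nxy : ~~ adj x y.
  case: b xm ym => xm ym.
    apply: (C5_common_trans (i := i) (y := v i.+1)); rewrite ?x0 ?x2 ?y0 ?y2 ?C5_mid //.
    by rewrite adj_sym.
  apply: (C5_common_trans (i := i.+3) (y := v i.+4));
    rewrite ?C5_mid ?C5_periodic5 ?x0 ?x3 ?y0 ?y3 //.
  by rewrite adj_sym.
apply/eqP; rewrite eq_sym; apply: contraT => xy.
have [_ n02 n03 _] := C5_adj i; have [a23 _ _ _] := C5_adj i.+2.
have := no_coP2P3 x y (v i.+2) (v i) (v i.+3); rewrite /is_coP2P3 xy nxy.
by rewrite x0 x2 x3 y0 y2 y3 [adj _ (v i)]adj_sym n02 n03 a23.
Qed.

Lemma C5_S_indep i x y : x \in C5_S i -> y \in C5_S i -> ~~ adj x y.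
Proof.
rewrite !inE => /and5P [x4 x1 x0 _ _] /and5P [y4 y1 y0 _ _].
apply: (C5_common_trans (i := i.+4) (y := v i.+4.+1)); rewrite ?C5_mid //.
- by rewrite x4 /= -[i.+4.+2]/(i.+1.+4.+1) C5_periodic5.
- by rewrite y4 /= -[i.+4.+2]/(i.+1.+4.+1) C5_periodic5.
- by rewrite C5_periodic5.
- by rewrite C5_periodic5 adj_sym.
Qed.

(** Given two such vertices, the complement of P_2 + P_3 forbids each to see the other's neighbour
    in [C5_S i.+2]; the two edges then form a 2P_2. *)
Lemma card_C5_F i : #|C5_F i| <= 1.
Proof.
apply/card_le1P=> x /setIdP [xS /existsP [y /andP [yS xy]]] x'; rewrite [RHS]inE.
apply/idP/eqP => [|->]; last first.
  by apply/setIdP; split=> //; apply/existsP; exists y; rewrite yS.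
move=> /setIdP [x'S /existsP [y' /andP [y'S x'y']]].
apply/eqP; rewrite eq_sym; apply: contraT => xx'.
have nxx' := C5_S_indep xS x'S.
have n41 : ~~ adj (v i.+4) (v i.+1).
  by have [_ _ n14 _] := C5_adj i.+1; rewrite adj_sym.
have [_ n13 _ _] := C5_adj i.+1.
move: (xS) (x'S) (yS) (y'S); rewrite !inE !C5_periodic5.
move=> /and5P [x4 x1 x0 x2 x3] /and5P [x'4 x'1 x'0 x'2 x'3].
move=> /and5P [y1 y3 y2 y4 y0] /and5P [y'1 y'3 y'2 y'4 y'0].
have unique_x w z t : w != z -> ~~ adj w z -> adj w (v i.+4) -> adj w (v i.+1) ->
  adj z (v i.+4) -> adj z (v i.+1) -> adj w t -> adj t (v i.+1) -> ~~ adj t (v i.+4) ->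
  ~~ adj z t.
  move=> wz nwz w4 w1 z4 z1 wt t1 t4; apply/negP=> zt.
  have := no_coP2P3 w z t (v i.+4) (v i.+1); rewrite /is_coP2P3 wz nwz wt w4 w1.
  by rewrite zt z4 z1 t4 n41 t1.
have unique_y w z t : w != z -> ~~ adj w z -> adj w (v i.+1) -> adj w (v i.+3) ->
  adj z (v i.+1) -> adj z (v i.+3) -> adj w t -> adj t (v i.+1) -> ~~ adj t (v i.+3) ->
  ~~ adj z t.
  move=> wz nwz w1 w3 z1 z3 wt t1 t3; apply/negP=> zt.
  have := no_coP2P3 w z t (v i.+3) (v i.+1); rewrite /is_coP2P3 wz nwz wt w1 w3.
  by rewrite zt z1 z3 t3 [adj (v _) _]adj_sym n13 t1.
have nx'y : ~~ adj x' y by apply: (unique_x x).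
have yy' : y != y' by apply: contraNneq nx'y => ->.
have nyy' := C5_S_indep yS y'S.
have ny'x : ~~ adj y' x by apply: (unique_y y); rewrite // adj_sym.
have := edge_meets xy x'y'.
by rewrite (negbTE nxx') [adj x y']adj_sym (negbTE ny'x) [adj y x']adj_sym
  (negbTE nx'y) (negbTE nyy').
Qed.

Lemma card_C5_exceptional : #|C5_exceptional| <= 15.
Proof.
have -> : 15 = \sum_(i < 5) 3 by rewrite sum_nat_const card_ord.
rewrite /C5_exceptional; elim/big_rec2: _ => [|i n A _ An]; first by rewrite cards0.
apply: leq_trans (leq_card_setU _ _) _; rewrite leq_add //.
apply: leq_trans (leq_card_setU _ _) _.
apply: (@leq_add _ _ 2 1); last exact: card_C5_F.
apply: leq_trans (leq_card_setU _ _) _.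
by apply: (@leq_add _ _ 1 1); exact: card_C5_B.
Qed.

Let v5 : v 5 = v 0 := C5_periodic5 0.
Let v6 : v 6 = v 1 := C5_periodic5 1.
Let v7 : v 7 = v 2 := C5_periodic5 2.
Let v8 : v 8 = v 3 := C5_periodic5 3.

Lemma C5_exceptionalPn x : x \notin C5_exceptional -> forall i, i < 5 ->
  [/\ x \notin C5_B i true, x \notin C5_B i false & x \notin C5_F i].
Proof.
move=> xE i i5; apply/and3P; rewrite andbA -!negb_or; apply: contra xE => xi.
by apply/bigcupP; exists (Ordinal i5); rewrite // !in_setU.
Qed.

(** By [C5_nbr], the only neighbourhoods on the cycle besides these three kinds have three or four
    vertices and belong to some [C5_B]. *)
Lemma C5_cases x : x \notin C5_exceptional ->
  [\/ forall i, adj x (v i), forall i, ~~ adj x (v i) | exists i : 'I_5, x \in C5_S i].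
Proof.
move=> /C5_exceptionalPn xE.
have [+ + _] := xE 0 isT; have [+ + _] := xE 1 isT; have [+ + _] := xE 2 isT.
have [+ + _] := xE 3 isT; have [+ + _] := xE 4 isT.
rewrite !inE v5 v6 v7 v8.
move: (@C5_nbr x 0) (@C5_nbr x 1) (@C5_nbr x 2) (@C5_nbr x 3) (@C5_nbr x 4).
rewrite v5 v6 v7.
have S (i : 'I_5) : x \in C5_S i -> [\/ forall i, adj x (v i), forall i, ~~ adj x (v i)
    | exists i : 'I_5, x \in C5_S i] by move=> xi; apply: Or33; exists i.
move: (S (@Ordinal 5 0 isT)) (S (@Ordinal 5 1 isT)) (S (@Ordinal 5 2 isT)).
move: (S (@Ordinal 5 3 isT)) (S (@Ordinal 5 4 isT)).
rewrite !inE /= v5 v6 v7 v8.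
case x0: (adj x (v 0)); case x1: (adj x (v 1)); case x2: (adj x (v 2));
  case x3: (adj x (v 3)); case x4: (adj x (v 4)) => //=; auto.
- move=> *; apply: Or31; elim/ltn_ind => -[|[|[|[|[|i]]]]] IH //.
  by rewrite C5_periodic5 IH //; lia.
- move=> *; apply: Or32; elim/ltn_ind => -[|[|[|[|[|i]]]]] IH;
    rewrite ?x0 ?x1 ?x2 ?x3 ?x4 //.
  by rewrite C5_periodic5 IH //; lia.
Qed.

Lemma C5_S_next i x y : x \in C5_S i -> y \in C5_S i.+1 -> adj x y.
Proof.
rewrite !inE C5_periodic5.
case/and5P=> x4 x1 x0 x2 x3 /and5P [y0 y2 y1 y3 y4].
have [_ n24 _ _] := C5_adj i.+2.
have := edge_meets x4 y2; rewrite (negbTE x2).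
rewrite [adj _ (v i.+2)]adj_sym (negbTE n24) [adj (v _) y]adj_sym.
by rewrite (negbTE y4) !orbF.
Qed.

Lemma C5_S_full i x u : x \in C5_S i -> (forall j, adj u (v j)) -> adj x u.
Proof.
rewrite !inE => /and5P [x4 x1 x0 _ _] uC; apply: contraT => nxu.
have := @C5_common_trans i.+4 x (v i.+4.+1) u; rewrite C5_mid.
rewrite -[i.+4.+2]/(i.+1.+4.+1) !C5_periodic5 x4 x1 !uC.
by rewrite [adj (v i) u]adj_sym uC [adj _ x]adj_sym; apply.
Qed.

Lemma C5_S_empty i x z : x \in C5_S i -> (forall j, ~~ adj z (v j)) -> ~~ adj x z.
Proof.
rewrite !inE => /and5P [_ _ _ x2 x3] zC; apply/negP=> /(C5_edge_cover i.+2 zC).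
by rewrite (negbTE x2) (negbTE x3).
Qed.

Lemma C5_full_clique u w : (forall j, adj u (v j)) -> (forall j, adj w (v j)) ->
  u != w -> adj u w.
Proof.
move=> uC wC uw; apply: contraT => nuw.
have [_ n02 n03 _] := C5_adj 0; have [a23 _ _ _] := C5_adj 2.
have := no_coP2P3 u w (v 2) (v 0) (v 3); rewrite /is_coP2P3 uw nuw !uC !wC a23 n03.
by rewrite adj_sym n02.
Qed.

Lemma C5_empty_indep z w : (forall j, ~~ adj z (v j)) -> (forall j, ~~ adj w (v j)) ->
  ~~ adj z w.
Proof.
by move=> zC wC; apply/negP=> /(C5_edge_cover 0 wC); rewrite !(negbTE (zC _)).
Qed.

(** If [p] misses [v j], it sees both neighbours of [v j] and, were it to miss [u], non-adjacency
    would pass from [p] to the pair [v j], [u]. *)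
Lemma C5_full_cover u p : (forall j, adj u (v j)) ->
  (forall j, adj p (v j) || adj p (v j.+1)) -> u != p -> adj u p.
Proof.
move=> uC pC up; have [|/existsNP [j /negP pj]] := pselect (forall j, adj p (v j)).
  by move=> ?; apply: C5_full_clique.
have := pC j; have := pC j.+4; rewrite C5_periodic5 (negbTE pj) orbF /= => p4 p1.
apply: contraT => nup; have := @C5_common_trans j.+4 p (v j.+4.+1) u.
rewrite C5_mid -[j.+4.+2]/(j.+1.+4.+1) !C5_periodic5 p4 p1 !uC.
by rewrite [adj (v j) u]adj_sym uC [adj _ p]adj_sym [adj p u]adj_sym; apply.
Qed.

Lemma C5_full_empty u z : atom G -> (forall j, adj u (v j)) ->
  (forall j, ~~ adj z (v j)) -> adj u z.
Proof.
move=> atomG uC zC.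
have zv0 : z != v 0.
  by apply: contraNneq (zC 1) => ->; case: (C5_adj 0).
have [p [q [zp zq pq npq]]] := atom_nbhd atomG zv0 (zC 0).
have cover t i : adj z t -> adj t (v i) || adj t (v i.+1).
  by move=> zt; apply: (@C5_edge_cover _ z) => //; rewrite adj_sym.
have [<-|up] := eqVneq p u; first by rewrite adj_sym.
have [<-|uq] := eqVneq q u; first by rewrite adj_sym.
rewrite eq_sym in up; rewrite eq_sym in uq.
have au_p : adj u p by apply: C5_full_cover => // j; apply: cover.
have au_q : adj u q by apply: C5_full_cover => // j; apply: cover.
(* Both [p] and [q] see a vertex cover of the cycle; a cover of C_5 has at least three vertices, so
   two covers intersect. *)
have [j pj qj] : exists2 j, adj p (v j) & adj q (v j).
{ move: (cover p 0 zp) (cover p 1 zp) (cover p 2 zp) (cover p 3 zp) (cover p 4 zp).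
  move: (cover q 0 zq) (cover q 1 zq) (cover q 2 zq) (cover q 3 zq) (cover q 4 zq).
  rewrite v5; case p0: (adj p (v 0)); case q0: (adj q (v 0)); try by exists 0.
  all: case p1: (adj p (v 1)); case q1: (adj q (v 1)); try by exists 1.
  all: case p2: (adj p (v 2)); case q2: (adj q (v 2)); try by exists 2.
  all: case p3: (adj p (v 3)); case q3: (adj q (v 3)); try by exists 3.
  all: by case p4: (adj p (v 4)); case q4: (adj q (v 4)); try by exists 4. }
apply: contraT => nuz; have := uC j; apply: contraLR => _.
by apply: (nonadj_trans pq npq (y := z)) => //; rewrite adj_sym.
Qed.

(** One layer suffices: outside the exceptional set the twin class, or being full or empty on the
    cycle, decides every adjacency. *)
Lemma atom_C5_cw : atom G -> cw G <= layered_bound #|{: 'I_5 + bool}| 15.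
Proof.
move=> atomG; pose E := C5_exceptional.
pose col x : 'I_5 + bool :=
  if [pick i : 'I_5 | x \in C5_S i] is Some i then inl i else inr (adj x (v 0)).
pose M (_ : bool) (k l : 'I_5 + bool) := match k, l with
  | inl i, inl j => adj (v i) (v j)
  | inl _, inr b | inr b, inl _ => b
  | inr b, inr b' => b || b'
  end.
have SP i : C5_S i.+4.+1 = C5_S i.
  apply/setP=> x; rewrite !inE -[i.+4.+1.+4]/(i.+4.+4.+1) -[i.+4.+1.+1]/(i.+1.+4.+1).
  by rewrite -[i.+4.+1.+2]/(i.+2.+4.+1) -[i.+4.+1.+3]/(i.+3.+4.+1) !C5_periodic5.
pose Q i j := forall x y, x \notin E -> y \notin E -> x \in C5_S i -> y \in C5_S j ->
  adj x y = adj (v i) (v j).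
have Qsym i j : Q i j -> Q j i.
  by move=> Qij x y xE yE xi yj; rewrite adj_sym (Qij y x) // adj_sym.
have Q0 i : Q i i.
  by move=> x y _ _ xi yi; rewrite adj_irr; apply/negbTE/(C5_S_indep xi yi).
have Q1 i : Q i i.+1.
  move=> x y _ _ xi yi; have [-> _ _ _] := C5_adj i; exact: (C5_S_next xi yi).
(* The exceptional set contains [C5_F i] only for [i < 5]; pairs that wrap around are brought back
   by [SP]. *)
have Q2 i : i < 5 -> Q i i.+2.
  move=> i5 x y xE _ xi yi; have [_ /negbTE -> _ _] := C5_adj i.
  have [_ _ xF] := C5_exceptionalPn xE i5; apply: contraNF xF => xy.
  by apply/setIdP; split=> //; apply/existsP; exists y; rewrite yi.
have Q40 : Q 4 0 by have := Q1 4; rewrite /Q v5 SP.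
have Q30 : Q 3 0 by have := Q2 3 isT; rewrite /Q v5 SP.
have Q41 : Q 4 1 by have := Q2 4 isT; rewrite /Q v6 SP.
have QQ (i j : 'I_5) : Q i j.
{ case: i j => [[|[|[|[|[|//]]]]] ?] [[|[|[|[|[|//]]]]] ?] /=.
  all: first [exact: Q0 | exact: Q1 | exact: Q2 | exact: Q40 | exact: Q30
    | exact: Q41 | apply: Qsym; first [exact: Q1 | exact: Q2 | exact: Q40
    | exact: Q30 | exact: Q41]]. }
have colP x : x \notin E ->
    (exists2 i : 'I_5, col x = inl i & x \in C5_S i) \/
    (col x = inr true /\ forall j, adj x (v j)) \/
    (col x = inr false /\ forall j, ~~ adj x (v j)).
  move=> xE; rewrite /col; case: pickP => [i xi|nS]; first by left; exists i.
  right; case: (C5_cases xE) => [xC|xC|[i]]; last by rewrite nS.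
    by left; rewrite xC.
  by right; rewrite (negbTE (xC 0)).
apply: leq_trans (@layered_cw_up_to _ E _ (fun=> 0) col M _) _.
  move=> x y; rewrite !in_setC => xE yE xy _.
  case: (colP x xE) => [[i -> xi]|[[-> xC]|[-> xC]]];
  case: (colP y yE) => [[j -> yj]|[[-> yC]|[-> yC]]] /=.
  - exact: QQ.
  - exact: C5_S_full xi yC.
  - exact/negbTE/(C5_S_empty xi yC).
  - by rewrite adj_sym; exact: C5_S_full yj xC.
  - exact: C5_full_clique.
  - exact: C5_full_empty.
  - by rewrite adj_sym; apply/negbTE/(C5_S_empty yj xC).
  - by rewrite adj_sym; exact: C5_full_empty.
  - exact/negbTE/C5_empty_indep.
by apply: leq_layered_bound; exact: card_C5_exceptional.
Qed.

End C5.

(** * Combining the cases *)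

Lemma C5_cycle a b c d e : is_C5 a b c d e -> exists v : nat -> G,
  (forall i, v (i + 5) = v i) /\
  forall i, is_C5 (v i) (v i.+1) (v i.+2) (v i.+3) (v i.+4).
Proof.
move=> C; pose v i := nth a [:: a; b; c; d; e] (i %% 5).
have vp i : v (i + 5) = v i by rewrite /v modnDr.
exists v; split=> // i.
have rot a' b' c' d' e' : is_C5 a' b' c' d' e' -> is_C5 b' c' d' e' a'.
  case/and5P=> /and5P [ab bc cd de ea] ac bd ce /andP [da eb].
  by rewrite /is_C5 ab bc cd de ea bd ce da eb ac.
elim/ltn_ind: i => i IH; have [i5|] := leqP 5 i.
  by rewrite -(subnK i5) -!addSn !vp; apply: IH; lia.
have C1 := rot _ _ _ _ _ C; have C2 := rot _ _ _ _ _ C1.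
have C3 := rot _ _ _ _ _ C2; have C4 := rot _ _ _ _ _ C3.
by move: i {IH} => [|[|[|[|[|//]]]]].
Qed.

(** The three summands bound complete graphs, atoms with a C_4 but no C_5, and atoms with a C_5. *)
Lemma atom_cw : atom G -> cw G <=
  layered_bound #|{: unit}| 0 + (layered_bound #|{: option bool}| 4 +
    layered_bound #|{: 'I_5 + bool}| 15).
Proof.
move=> atomG.
have [[a [b [c [d [e C]]]]]|noC5] := pselect (exists a b c d e, is_C5 a b c d e).
  have [v [vp vC]] := C5_cycle C.
  by rewrite addnA; apply: leq_trans (leq_addl _ _); exact: atom_C5_cw vp vC atomG.
have no_C5 a b c d e : ~~ is_C5 a b c d e.
  by apply/negP=> C; apply: noC5; exists a, b, c, d, e.
have [[b [w [bw nbw]]]|complete] := pselect (exists b w, b != w /\ ~~ adj b w).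
  have [[a' [b' [c' [d' C]]]]|//] := atom_C4_or_C5 atomG bw nbw.
  rewrite addnCA; apply: leq_trans (leq_addr _ _); exact: atom_C4_cw C no_C5.
apply: leq_trans (leq_addr _ _); rewrite -[X in layered_bound _ X](cards0 G).
apply: (@layered_cw_up_to G set0 _ (fun=> 0) (fun=> tt) (fun _ _ _ => true)).
move=> x y _ _ xy _; apply: contrapT => nxy; apply: complete; exists x, y.
by split=> //; apply/negP.
Qed.
End Free.

Theorem theorem2 :
  bounded_cw (fun G : sgraph =>
    atom G /\
    free2 (copies 2 (path_graph 2))
          (complement (disjoint_union (path_graph 2) (path_graph 3))) G)
  /\
  ~ bounded_cw (fun G : sgraph =>
    free2 (copies 2 (path_graph 2))
          (complement (disjoint_union (path_graph 2) (path_graph 3))) G).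
Proof.
split; last by apply: unbounded_cw_split_graphs => m; exact: split_graph_free.
eexists => G [atomG []]; rewrite induced_2P2P induced_coP2P3P => no1 no2.
apply: (@atom_cw G) => //.
- by move=> a b c d; apply/negP=> C; apply: no1; exists a, b, c, d.
- by move=> a b x y z; apply/negP=> C; apply: no2; exists a, b, x, y, z.
Qed.
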